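(* Fix $L\in\mathbb{N}$, $\rho,\lambda_\sigma,\alpha>0$, $\tau\ge0$, $\eta\ge1$. There exists $c>0$ depending only on $L,\rho,\lambda_\sigma,\tau,\alpha,\eta$ such that whenever: (1) the random elements $X,(W_0,B_0),\dots,(W_{L-1},B_{L-1})$ are stochastically independent; (2) each of $X$ (as a random vector in $\mathbb{R}^{n_0n}$) and $(W_\ell,B_\ell)$ (as a random vector in $\mathbb{R}^{n_{\ell+1}n_\ell+n_{\ell+1}}$) satisfies the subgaussian concentration property with constant $\rho$; (3) $X$ and $W_\ell,B_\ell$ are centered; (4) each $\sigma_\ell$ is $\lambda_\sigma$-Lipschitz with $|\sigma_\ell(0)|\le\tau$; (5) $n/n_\ell\le\alpha$ for $\ell=1,\dots,L$; (6) $n_0\ge\eta$; then for every $F\colon\mathbb{R}^{n_L\times n}\to\mathbb{R}$, $1$-Lipschitz with respect to the Hilbert--Schmidt norm, and every $t>0$, $$\mathbb{P}(|F(Z_L)-\mathbb{E}F(Z_L)|\ge t)\le2\exp\Big(-c\min_{1\le k\le L+1}n^{(k-1)/k}t^{2/k}\Big).$$ If in addition $\sup_x|\sigma_{L-1}(x)|\le\kappa$, then $\mathbb{P}(|F(Z_L)-\mathbb{E}F(Z_L)|\ge t)\le2\exp(-c't^2)$ for all $t>0$, for some $c'>0$ depending only on $L,\rho,\lambda_\sigma,\tau,\kappa,\alpha,\eta$. Moreover, if $\alpha\to0$ and $\eta\to\infty$ simultaneously with the other parameters fixed, the optimal (largest) constants $c_{opt},c'_{opt}$ for which these inequalities hold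 for all models satisfying the assumptions diverge to $\infty$.
   Context: Model: $L,n_0,\dots,n_L,n$ positive integers; $X$ an $n_0\times n$ random matrix, $W_\ell$ an $n_{\ell+1}\times n_\ell$ random matrix, $B_\ell$ a random vector in $\mathbb{R}^{n_{\ell+1}}$, $\sigma_\ell\colon\mathbb{R}\to\mathbb{R}$, $\ell=0,\dots,L-1$; functions act on matrices entrywise. $Z_0=n_0^{-1/2}X$, $Z_{\ell+1}=n_{\ell+1}^{-1/2}\sigma_\ell(W_\ell Z_\ell+B_\ell\mathbf{1}_n^T)$, $\mathbf{1}_n$ the all-ones vector. A random vector $Y$ in $\mathbb{R}^M$ satisfies the subgaussian concentration property with constant $\rho$ if for every Euclidean $1$-Lipschitz $G\colon\mathbb{R}^M\to\mathbb{R}$ and $t>0$, $\mathbb{P}(|G(Y)-\mathrm{Med}\,G(Y)|\ge t)\le2e^{-t^2/\rho^2}$ (any median). Centered means entries have mean zero. $\|\cdot\|_{HS}$ is the Hilbert--Schmidt norm. *)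

(* Defs.v *)
From HB Require Import structures.
From mathcomp Require Import all_boot all_order all_algebra.
From mathcomp Require Import all_classical all_reals all_analysis.
Set Implicit Arguments. Unset Strict Implicit. Unset Printing Implicit Defensive.
Import Order.TTheory GRing.Theory Num.Theory.
Local Open Scope classical_set_scope.
Local Open Scope ring_scope.

Section NetDefs.
Context {R : realType}.

Definition eucl (I : finType) (x : I -> R) : R := Num.sqrt (\sum_(i : I) x i ^+ 2).

Definition hsnorm (m k : nat) (A : 'M[R]_(m, k)) : R :=
  Num.sqrt (\sum_(i < m) \sum_(j < k) A i j ^+ 2).

Definition lip1_eucl (I : finType) (G : (I -> R) -> R) : Prop :=
  forall x y : I -> R, `|G x - G y| <= eucl (fun i => x i - y i).

Definition lip1_hs (m k : nat) (F : 'M[R]_(m, k) -> R) : Prop :=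
  forall A B : 'M[R]_(m, k), `|F A - F B| <= hsnorm (A - B).

Definition lipschitz_R (lam : R) (s : R -> R) : Prop :=
  forall x y : R, `|s x - s y| <= lam * `|x - y|.

Section Prob.
Context {d : measure_display} {T : measurableType d} (P : probability T R).

Definition is_median (Y : T -> R) (m : R) : Prop :=
  ((1/2)%:E <= P [set w | (m <= Y w)%R])%E /\ ((1/2)%:E <= P [set w | (Y w <= m)%R])%E.

Definition subgauss_conc (I : finType) (Y : T -> I -> R) (rho : R) : Prop :=
  forall G : (I -> R) -> R, lip1_eucl G ->
  forall m : R, is_median (fun w => G (Y w)) m ->
  forall t : R, 0 < t ->
    (P [set w | (t <= `|G (Y w) - m|)%R] <= (2 * expR (- (t ^+ 2) / rho ^+ 2))%:E)%E.

Definition sigma_gen (I : finType) (Y : T -> I -> R) : set (set T) :=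
  <<s [set E | exists (i : I) (A : set R), measurable A /\
                 E = (fun w => Y w i) @^-1` A] >>.

Definition random_vec (I : finType) (Y : T -> I -> R) : Prop :=
  forall i : I, measurable_fun setT (fun w => Y w i).

Definition centered (I : finType) (Y : T -> I -> R) : Prop :=
  forall i : I, ('E_P[fun w => Y w i] = 0)%E.

End Prob.

Definition mxvecf (m k : nat) (A : 'M[R]_(m, k)) : 'I_m * 'I_k -> R :=
  fun p => A p.1 p.2.

Definition wbvec (m k : nat) (W : 'M[R]_(m, k)) (B : 'cV[R]_m)
  : ('I_m * 'I_k) + 'I_m -> R :=
  fun s => match s with inl p => W p.1 p.2 | inr i => B i ord0 end.

Fixpoint Znet (n : nat) (ns : nat -> nat) (sigma : nat -> R -> R)
  (X : 'M[R]_(ns 0%N, n)) (W : forall l : nat, 'M[R]_(ns l.+1, ns l))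
  (B : forall l : nat, 'cV[R]_(ns l.+1)) (l : nat) : 'M[R]_(ns l, n) :=
  match l return 'M[R]_(ns l, n) with
  | 0%N => (Num.sqrt (ns 0%N)%:R)^-1 *: X
  | l'.+1 => (Num.sqrt (ns l'.+1)%:R)^-1 *:
       map_mx (sigma l') (W l' *m Znet sigma X W B l' + B l' *m const_mx 1)
  end.

Definition model_ok (L : nat) (rho lam tau alpha eta : R)
  {d : measure_display} {T : measurableType d} (P : probability T R)
  (ns : nat -> nat) (n : nat) (sigma : nat -> R -> R)
  (X : T -> 'M[R]_(ns 0%N, n)) (W : forall l : nat, T -> 'M[R]_(ns l.+1, ns l))
  (B : forall l : nat, T -> 'cV[R]_(ns l.+1)) : Prop :=
  [/\
    (0 < n)%N /\ (forall l, (l <= L)%N -> (0 < ns l)%N),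
    random_vec (fun w => mxvecf (X w)) /\
      (forall l, (l < L)%N -> random_vec (fun w => wbvec (W l w) (B l w))),
    (forall (E0 : set T) (E : nat -> set T),
        sigma_gen (fun w => mxvecf (X w)) E0 ->
        (forall l, (l < L)%N -> sigma_gen (fun w => wbvec (W l w) (B l w)) (E l)) ->
        fine (P (E0 `&` \bigcap_(l in `I_L) E l)) =
          fine (P E0) * \prod_(l < L) fine (P (E l))),
    subgauss_conc P (fun w => mxvecf (X w)) rho /\
      (forall l, (l < L)%N -> subgauss_conc P (fun w => wbvec (W l w) (B l w)) rho) &
    [/\
    centered P (fun w => mxvecf (X w)) /\
      (forall l, (l < L)%N -> centered P (fun w => wbvec (W l w) (B l w))),
    (forall l, (l < L)%N -> lipschitz_R lam (sigma l) /\ `|sigma l 0| <= tau),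
    (forall l, (1 <= l <= L)%N -> n%:R / (ns l)%:R <= alpha) &
    eta <= (ns 0%N)%:R ] ].

(** min_{1 <= k <= L+1} n^{(k-1)/k} t^{2/k}  (k = j+1, j < L+1). *)
Definition tail_rate (L n : nat) (t : R) : R :=
  \big[Order.min/t ^+ 2]_(j < L.+1)
     ((n%:R) `^ (j%:R / (j.+1)%:R) * t `^ (2 / (j.+1)%:R)).

(** Constant c is valid for the first inequality, for all models with
    parameters (L, rho, lam, tau, alpha, eta). The integrability of F(Z_L)
    (implicit in the paper, which uses E F(Z_L)) is part of the claim. *)
Definition valid_c1 (L : nat) (rho lam tau alpha eta c : R) : Prop :=
  forall (d : measure_display) (T : measurableType d) (P : probability T R)
    (ns : nat -> nat) (n : nat) (sigma : nat -> R -> R)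
    (X : T -> 'M[R]_(ns 0%N, n)) (W : forall l : nat, T -> 'M[R]_(ns l.+1, ns l))
    (B : forall l : nat, T -> 'cV[R]_(ns l.+1)),
  model_ok L rho lam tau alpha eta P sigma X W B ->
  forall F : 'M[R]_(ns L, n) -> R, lip1_hs F ->
  let FZ := fun w => F (Znet sigma (X w) (fun l => W l w) (fun l => B l w) L) in
  P.-integrable setT (fun w => (FZ w)%:E) /\
  forall t : R, 0 < t ->
    (P [set w | (t <= `|FZ w - fine ('E_P[FZ])|)%R]
       <= (2 * expR (- c * tail_rate L n t))%:E)%E.

Definition valid_c2 (L : nat) (rho lam tau kappa alpha eta c : R) : Prop :=
  forall (d : measure_display) (T : measurableType d) (P : probability T R)
    (ns : nat -> nat) (n : nat) (sigma : nat -> R -> R)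
    (X : T -> 'M[R]_(ns 0%N, n)) (W : forall l : nat, T -> 'M[R]_(ns l.+1, ns l))
    (B : forall l : nat, T -> 'cV[R]_(ns l.+1)),
  model_ok L rho lam tau alpha eta P sigma X W B ->
  (forall x : R, `|sigma L.-1 x| <= kappa) ->
  forall F : 'M[R]_(ns L, n) -> R, lip1_hs F ->
  let FZ := fun w => F (Znet sigma (X w) (fun l => W l w) (fun l => B l w) L) in
  P.-integrable setT (fun w => (FZ w)%:E) /\
  forall t : R, 0 < t ->
    (P [set w | (t <= `|FZ w - fine ('E_P[FZ])|)%R]
       <= (2 * expR (- c * t ^+ 2))%:E)%E.

End NetDefs.

(* Main.v *)
(** Condition on Z_l and average over the next layer: if F is 1-Lipschitz, then
    f(Z) = E F(layer(Z)) is (2 rho lam)-Lipschitz, because W is centered with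
    covariance of order rho^2 and hence E |W D|^2 <= 4 rho^2 m |D|^2; no operator
    norm of W enters.  So F(Z_(l+1)) - E F(Z_(l+1)) splits into f(Z_l) - E f(Z_l),
    controlled by induction, and F(Z_(l+1)) - f(Z_l), which given Z_l is subgaussian
    with variance proxy of order (|Z_l|^2 + n) / n_(l+1) <= alpha (1 + |Z_l|^2 / n).
    Since |.| is itself 1-Lipschitz and E |Z_l|^2 = O(n), the induction hypothesis
    also bounds the tail of |Z_l|; optimizing over the truncation level of |Z_l|
    produces one more term in the minimum.  Every constant obtained this way is
    proportional to min(1/alpha, eta), which gives the divergence. *)
Require Import Defs.
From HB Require Import structures.
From mathcomp Require Import all_boot all_order all_algebra.
From mathcomp Require Import all_classical all_reals all_analysis.
From mathcomp Require Import measurable_realfun.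
From mathcomp Require Import ring lra.
Import Order.TTheory GRing.Theory Num.Theory.
Set Implicit Arguments. Unset Strict Implicit. Unset Printing Implicit Defensive.
Local Open Scope classical_set_scope.
Local Open Scope ring_scope.

(** * The tail rate *)

(** Truncation cannot be avoided: the conditional variance of the next layer grows with |Z_l|, which
    is unbounded, so each layer costs one more root of t. In the variable v = t^2/n the k-th term of
    the rate is n v^(1/k). All terms agree at v = 1; below it the first is the smallest, above it
    the last, so a new layer changes the rate only for t beyond sqrt n.

    All random elements live on one probability space [T], so conditioning on the past has to be
    constructed. [T] is given two smaller sigma-algebras, that of the input and earlier layers and
    that of the last layer. Independence makes the law of w |-> (w, w) a product measure, and
    freezing the first copy of w plays the role of conditioning on Z_l.

    The hypothesis speaks of medians, whereas the induction runs on means. Each use of subgaussian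
    concentration therefore passes from median to mean, which is the origin of the factor 50 in the
    exponents. *)

Lemma tail_rate_termE (R : realType) (n j : nat) (t : R) :
  (0 < n)%N -> 0 < t ->
  n%:R `^ (j%:R / j.+1%:R) * t `^ (2 / j.+1%:R)
    = n%:R * (t ^+ 2 / n%:R) `^ (j.+1%:R)^-1.
Proof.
move=> n0 t0.
have nR : (0 : R) < n%:R by rewrite ltr0n.
have j0 : (j.+1%:R : R) != 0 by rewrite pnatr_eq0.
rewrite powRM ?invr_ge0 ?ler0n ?sqr_ge0 //.
have -> : (t ^+ 2) `^ (j.+1%:R)^-1 = t `^ (2 / j.+1%:R).
  by rewrite -powR_mulrn ?(ltW t0) // -powRrM.
have -> : (n%:R^-1 : R) `^ (j.+1%:R)^-1 = n%:R `^ (- (j.+1%:R)^-1).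
  by rewrite -powR_inv1 ?ler0n // -powRrM mulN1r.
rewrite [t `^ _ * _]mulrC mulrA; congr (_ * _).
have -> : (n%:R : R) * n%:R `^ (- (j.+1%:R)^-1) = n%:R `^ (1 - (j.+1%:R)^-1).
  by rewrite powRB ?powRN ?powRr1 // (gt_eqF nR) implybT.
congr (_ `^ _); field.
by rewrite -natr1 in j0 *; rewrite addrC.
Qed.

(** Every lower bound on the rate is proved term by term, and every upper bound by picking one term,
    always in the form n v^(1/k) with v = t^2/n. *)
Lemma tail_rate_geP (R : realType) (L n : nat) (t x : R) : (0 < n)%N -> 0 < t ->
  reflect (forall j, (j <= L)%N -> x <= n%:R * (t ^+ 2 / n%:R) `^ (j.+1%:R)^-1)
    (x <= tail_rate L n t).
Proof.
move=> n0 t0; have nR : (0 : R) < n%:R by rewrite ltr0n.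
apply: (iffP idP) => [xle j jL | H].
  apply: (le_trans xle); rewrite -tail_rate_termE // /tail_rate.
  by rewrite -ltnS in jL; have := bigmin_le (t ^+ 2) (Ordinal jL) _; apply.
apply: le_bigmin => [|j _]; last by rewrite tail_rate_termE // H // -ltnS.
(* The default value [t ^+ 2] of the minimum coincides with its term [j = 0]. *)
move: (H 0%N (leq0n _)); rewrite invr1 powRr1 ?divr_ge0 ?sqr_ge0 ?ler0n //.
by rewrite mulrCA divff ?gt_eqF // mulr1.
Qed.

Lemma tail_rate_ge0 (R : realType) (L n : nat) (t : R) :
  (0 < n)%N -> 0 < t -> 0 <= tail_rate L n t.
Proof.
by move=> n0 t0; apply/tail_rate_geP => // j _; rewrite mulr_ge0 ?ler0n ?powR_ge0.
Qed.

Lemma tail_rate_le_sqr (R : realType) (L n : nat) (t : R) :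
  tail_rate L n t <= t ^+ 2.
Proof. exact: bigmin_le_id. Qed.

Lemma tail_rate_le_pred (R : realType) (L n : nat) (t : R) : (0 < n)%N -> 0 < t ->
  tail_rate L.+1 n t <= tail_rate L n t.
Proof.
move=> n0 t0; apply/tail_rate_geP => // j jL.
by have /tail_rate_geP := lexx (tail_rate L.+1 n t); apply => //; exact: leqW.
Qed.

(** Replacing t by t/a divides the k-th term by a^(2/k), which is at most a^2. This pays for halving
    t and for normalizing a Lipschitz constant. *)
Lemma tail_rate_scale (R : realType) (L n : nat) (a t : R) :
  (0 < n)%N -> 0 < t -> 1 <= a ->
  tail_rate L n t <= a ^+ 2 * tail_rate L n (t / a).
Proof.
move=> n0 t0 a1; have a0 : 0 < a by exact: lt_le_trans a1.
rewrite mulrC -ler_pdivrMr ?exprn_gt0 //; apply/tail_rate_geP => //.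
  by rewrite divr_gt0.
move=> j jL; rewrite ler_pdivrMr ?exprn_gt0 //.
have /tail_rate_geP := lexx (tail_rate L n t).
move=> /(_ n0 t0 j jL) /le_trans; apply; rewrite -[leRHS]mulrA ler_wpM2l ?ler0n //.
have -> : (t / a) ^+ 2 / n%:R = t ^+ 2 / n%:R * (a ^+ 2)^-1.
  by rewrite expr_div_n mulrAC.
rewrite [in leRHS]powRM ?divr_ge0 ?invr_ge0 ?sqr_ge0 ?ler0n // -[leRHS]mulrA ler_peMr ?powR_ge0 //.
rewrite -ler_pdivrMr ?exprn_gt0 // mul1r; apply: ger1_powR.
  by rewrite invr_gt0 exprn_gt0 // invf_le1 ?exprn_gt0 // exprn_ege1.
by rewrite invf_le1 ?ltr0Sn // ler1n.
Qed.

(** A converse to [tail_rate_le_sqr] for t of order at most sqrt n. With v = t^2/n <= b it amounts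
    to v <= b v^(1/k): for v <= 1 because v <= v^(1/k), and for v >= 1 because v <= b. *)
Lemma sqr_le_tail_rate (R : realType) (L n : nat) (b t : R) :
  (0 < n)%N -> 0 < t -> 1 <= b -> t ^+ 2 <= b * n%:R ->
  t ^+ 2 <= b * tail_rate L n t.
Proof.
move=> n0 t0 b1 tb; have b0 : 0 < b by exact: lt_le_trans b1.
have nR : (0 : R) < n%:R by rewrite ltr0n.
rewrite mulrC -ler_pdivrMr //; apply/tail_rate_geP => // j jL.
rewrite ler_pdivrMr //; set v := t ^+ 2 / n%:R.
have v0 : 0 < v by rewrite divr_gt0 ?exprn_gt0.
have -> : t ^+ 2 = n%:R * v by rewrite mulrCA divff ?gt_eqF // mulr1.
have vb : v <= b by rewrite ler_pdivrMr.
rewrite -mulrA ler_pM2l //.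
have j1 : (j.+1%:R : R)^-1 <= 1 by rewrite invf_le1 ?ltr0Sn // ler1n.
have [v1|/ltW v1] := leP v 1.
  apply: (@le_trans _ _ (v `^ (j.+1%:R)^-1)).
    by apply: ger1_powR => //; rewrite v0.
  by rewrite ler_peMr ?powR_ge0.
apply: (le_trans vb); rewrite ler_peMl ?(ltW b0) //.
by rewrite -[leLHS](powRr0 v); apply: ler_powR => //; rewrite invr_ge0 ler0n.
Qed.

(* With v = t^2/n, the choice u = max 1 (v^((L+1)/(L+2))) balances the tail of
   the previous layer at radius sqrt (n u) against the conditional Gaussian tail. *)
Lemma tail_rate_split (R : realType) (L n : nat) (t : R) : (0 < n)%N -> 0 < t ->
  exists u : R, [/\ 1 <= u,
    tail_rate L.+1 n t <= tail_rate L n (Num.sqrt (n%:R * u)) &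
    tail_rate L.+1 n t <= t ^+ 2 / u].
Proof.
move=> n0 t0; have nR : (0 : R) < n%:R by rewrite ltr0n.
(* At radius sqrt (n u) the ratio t^2/n becomes u, and since u >= 1 the smallest of the terms n
   u^(1/k), k <= L+1, is the last. *)
have rate_sqrt (u x : R) : 1 <= u -> x <= n%:R * u `^ (L.+1%:R)^-1 ->
    x <= tail_rate L n (Num.sqrt (n%:R * u)).
  move=> u1 xu; have u0 : 0 < u by exact: lt_le_trans u1.
  apply/tail_rate_geP => [//||j jL]; first by rewrite sqrtr_gt0 mulr_gt0.
  apply: (le_trans xu); rewrite ler_pM2l // sqr_sqrtr; last by rewrite mulr_ge0 ?(ltW u0) ?ler0n.
  have -> : n%:R * u / n%:R = u by rewrite mulrC mulKf ?gt_eqF.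
  apply: ler_powR => //.
  by rewrite lef_pV2 ?posrE ?ltr0Sn // ler_nat.
(* For t^2 <= n the choice u = 1 suffices, because the rate is at most t^2. *)
have [tn|nt] := leP (t ^+ 2) n%:R.
  exists 1; split => //; last by rewrite divr1 tail_rate_le_sqr.
  apply: rate_sqrt => //; rewrite powR1 mulr1.
  by apply: le_trans tn; exact: tail_rate_le_sqr.
set v := t ^+ 2 / n%:R.
have v1 : 1 <= v by rewrite ler_pdivlMr // mul1r ltW.
have v0 : 0 < v by exact: lt_le_trans v1.
have rv : tail_rate L.+1 n t <= n%:R * v `^ (L.+2%:R)^-1.
  by have /tail_rate_geP := lexx (tail_rate L.+1 n t); apply.
have L1 : (L.+1%:R : R) != 0 by rewrite pnatr_eq0.
have L2 : (L.+2%:R : R) != 0 by rewrite pnatr_eq0.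
have u1 : 1 <= v `^ (L.+1%:R / L.+2%:R).
  by rewrite -[leLHS](powRr0 v); apply: ler_powR => //; rewrite divr_ge0 ?ler0n.
exists (v `^ (L.+1%:R / L.+2%:R)); split => //.
  apply: rate_sqrt => //; rewrite -powRrM.
  by rewrite mulrAC mulfV // mul1r.
apply: (le_trans rv).
rewrite [t ^+ 2](_ : _ = n%:R * v); last by rewrite mulrCA divff ?gt_eqF // mulr1.
rewrite -mulrA ler_pM2l // -{2}[v]powRr1 ?(ltW v0) // -powRB; last first.
  by rewrite (gt_eqF v0) implybT.
rewrite le_eqVlt; apply/orP; left; apply/eqP; congr (_ `^ _).
by rewrite -[X in X - _](@divff _ L.+2%:R) // -mulrBl -natrB // subSnn mul1r.
Qed.

(** * Euclidean and Hilbert-Schmidt norms, measurability of Lipschitz functions *)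

Section Euclidean.
Context {R : realType} {I : finType}.
Implicit Types x y : I -> R.

Lemma eucl_ge0 x : 0 <= eucl x.
Proof. exact: sqrtr_ge0. Qed.

Lemma sqr_eucl x : eucl x ^+ 2 = \sum_i x i ^+ 2.
Proof. by rewrite sqr_sqrtr // sumr_ge0 // => i _; rewrite sqr_ge0. Qed.

Lemma eucl_eq0 x : eucl x = 0 -> forall i, x i = 0.
Proof.
move=> x0 i; apply/eqP; rewrite -sqrf_eq0; apply/eqP.
apply: (@psumr_eq0P _ I predT (fun i => x i ^+ 2)) => // [j _|].
  by rewrite sqr_ge0.
by rewrite -sqr_eucl x0 expr0n.
Qed.

(** Weighted AM-GM in each coordinate, 2 x_i y_i <= r x_i^2 + y_i^2 / r, with the weight r = |y|/|x|
    for which the sum of the right sides is exactly 2 |x| |y|. *)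
Lemma eucl_dot_le x y : \sum_i x i * y i <= eucl x * eucl y.
Proof.
have [/eucl_eq0 x0|xn] := eqVneq (eucl x) 0.
  by rewrite big1 ?mulr_ge0 ?eucl_ge0 // => i _; rewrite x0 mul0r.
have [/eucl_eq0 y0|yn] := eqVneq (eucl y) 0.
  by rewrite big1 ?mulr_ge0 ?eucl_ge0 // => i _; rewrite y0 mulr0.
have xp : 0 < eucl x by rewrite lt_def xn eucl_ge0.
have yp : 0 < eucl y by rewrite lt_def yn eucl_ge0.
have -> : eucl x * eucl y =
    \sum_i (x i ^+ 2 * (eucl y / eucl x) + y i ^+ 2 * (eucl x / eucl y)) / 2.
  rewrite -mulr_suml big_split /= -!mulr_suml -!sqr_eucl; field.
  by rewrite xn yn.
apply: ler_sum => i _; rewrite ler_pdivlMr // -subr_ge0.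
set r := eucl y / eucl x; have r0 : 0 < r by rewrite divr_gt0.
have -> : eucl x / eucl y = r^-1 by rewrite invf_div.
have -> : x i ^+ 2 * r + y i ^+ 2 * r^-1 - x i * y i * 2 = (x i * r - y i) ^+ 2 / r.
  by field; rewrite gt_eqF.
by rewrite divr_ge0 ?sqr_ge0 ?ltW.
Qed.

Lemma eucl_dot_norm_le x y : `|\sum_i x i * y i| <= eucl x * eucl y.
Proof.
rewrite ler_norml eucl_dot_le andbT lerNl.
have -> : eucl x = eucl (fun i => - x i).
  by rewrite /eucl; congr Num.sqrt; apply: eq_bigr => i _; rewrite sqrrN.
by rewrite -sumrN; under eq_bigr do rewrite -mulNr; exact: eucl_dot_le.
Qed.

Lemma eucl_triangle x y : eucl (fun i => x i + y i) <= eucl x + eucl y.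
Proof.
rewrite -(@ler_pXn2r _ 2) ?nnegrE ?addr_ge0 ?eucl_ge0 // sqr_eucl sqrrD !sqr_eucl.
have -> : \sum_i (x i + y i) ^+ 2
    = \sum_i x i ^+ 2 + (\sum_i x i * y i) *+ 2 + \sum_i y i ^+ 2.
  by rewrite -sumrMnl -!big_split /=; apply: eq_bigr => i _; rewrite sqrrD.
by rewrite lerD2r lerD2l lerMn2r eucl_dot_le orbT.
Qed.

Lemma lip1_eucl_eucl : lip1_eucl (@eucl R I).
Proof.
have le x y : eucl x <= eucl y + eucl (fun i => x i - y i).
  apply: le_trans (eucl_triangle _ _); rewrite le_eqVlt; apply/orP; left; apply/eqP.
  by congr eucl; apply/funext => i; rewrite addrC subrK.
move=> x y; rewrite ler_norml lerBlDl le andbT lerNl opprB lerBlDl.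
have -> : eucl (fun i => x i - y i) = eucl (fun i => y i - x i); last exact: le.
by rewrite /eucl; congr Num.sqrt; apply: eq_bigr => i _; rewrite -sqrrN opprB.
Qed.

Lemma eucl_le_sum x : eucl x <= \sum_i `|x i|.
Proof.
rewrite -(@ler_pXn2r _ 2) ?nnegrE ?sumr_ge0 ?eucl_ge0 // sqr_eucl expr2 mulr_suml.
apply: ler_sum => i _; rewrite -real_normK ?num_real // expr2 ler_wpM2l //.
by rewrite (bigD1 i) //= lerDl sumr_ge0.
Qed.

Lemma euclZ (c : R) x : eucl (fun i => c * x i) = `|c| * eucl x.
Proof.
rewrite -[RHS]ger0_norm ?mulr_ge0 ?eucl_ge0 // -sqrtr_sqr exprMn sqr_eucl.
rewrite -normrX ger0_norm ?sqr_ge0 // mulr_sumr.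
by congr Num.sqrt; apply: eq_bigr => i _; rewrite exprMn.
Qed.

End Euclidean.

Section HilbertSchmidt.
Context {R : realType}.

Lemma hsnormE (m k : nat) (A : 'M[R]_(m, k)) : hsnorm A = eucl (mxvecf A).
Proof. by rewrite /hsnorm /eucl pair_big. Qed.

Lemma hsnorm_ge0 (m k : nat) (A : 'M[R]_(m, k)) : 0 <= hsnorm A.
Proof. exact: sqrtr_ge0. Qed.

Lemma sqr_hsnorm (m k : nat) (A : 'M[R]_(m, k)) :
  hsnorm A ^+ 2 = \sum_i \sum_j A i j ^+ 2.
Proof. by rewrite hsnormE sqr_eucl pair_big. Qed.

Lemma hsnormZ (m k : nat) (c : R) (A : 'M[R]_(m, k)) :
  hsnorm (c *: A) = `|c| * hsnorm A.
Proof.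
by rewrite !hsnormE -euclZ; congr eucl; apply/funext => p; rewrite /mxvecf mxE.
Qed.

Lemma lip1_hs_hsnorm (m k : nat) : lip1_hs (@hsnorm R m k).
Proof.
move=> A B; rewrite !hsnormE; apply: le_trans (lip1_eucl_eucl _ _) _.
by rewrite le_eqVlt; apply/orP; left; apply/eqP; congr eucl; apply/funext => p;
  rewrite /mxvecf !mxE.
Qed.

Lemma hsnormD (m k : nat) (A B : 'M[R]_(m, k)) : hsnorm (A + B) <= hsnorm A + hsnorm B.
Proof.
rewrite !hsnormE; apply: le_trans (eucl_triangle _ _).
by rewrite le_eqVlt; apply/orP; left; apply/eqP; congr eucl; apply/funext => p;
  rewrite /mxvecf !mxE.
Qed.

(** Cauchy-Schwarz in each entry. It is applied only to increments of weights or biases, so the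
    possibly large norm of [W] itself never appears. *)
Lemma hsnormM (m k p : nat) (A : 'M[R]_(m, k)) (B : 'M[R]_(k, p)) :
  hsnorm (A *m B) <= hsnorm A * hsnorm B.
Proof.
rewrite -(@ler_pXn2r _ 2) ?nnegrE ?mulr_ge0 ?hsnorm_ge0 // exprMn !sqr_hsnorm.
rewrite mulr_suml; apply: ler_sum => i _.
rewrite [X in _ * X]exchange_big /= mulr_sumr; apply: ler_sum => j _.
rewrite mxE -!(sqr_eucl (fun l => _)) -exprMn -real_normK ?num_real //.
by rewrite ler_pXn2r ?nnegrE ?mulr_ge0 ?eucl_ge0 // eucl_dot_norm_le.
Qed.

Lemma hsnorm_map_lip (m k : nat) (lam : R) (s : R -> R) (A B : 'M[R]_(m, k)) :
  0 <= lam -> lipschitz_R lam s ->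
  hsnorm (map_mx s A - map_mx s B) <= lam * hsnorm (A - B).
Proof.
move=> lam0 slip.
rewrite -(@ler_pXn2r _ 2) ?nnegrE ?mulr_ge0 ?hsnorm_ge0 // exprMn !sqr_hsnorm mulr_sumr.
apply: ler_sum => i _; rewrite mulr_sumr; apply: ler_sum => j _.
rewrite !mxE -exprMn -real_normK ?num_real // -[leRHS]real_normK ?num_real //.
by rewrite ler_pXn2r ?nnegrE // normrM (ger0_norm lam0) slip.
Qed.

End HilbertSchmidt.

Section LipschitzMeasurable.
Context {R : realType} {d : measure_display} {T : measurableType d}.

(** [random_vec] gives measurable coordinates only, so the sets {G(Y) < a} have to be rebuilt as
    countable unions of sets described through the coordinates. *)
Lemma lip1_eucl_measurable (I : finType) (Y : T -> I -> R) (G : (I -> R) -> R) :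
  lip1_eucl G -> random_vec Y -> measurable_fun setT (fun w => G (Y w)).
Proof.
move=> Glip mY.
apply: (measurability (@RGenInftyO.G R)); first exact: RGenInftyO.measurableE.
move=> _ [_ [a ->] <-]; rewrite setTI.
pose q2r (q : {ffun I -> rat}) i : R := ratr (q i).
(* McShane's formula: G is the infimum of G q + |. - q| over rational points q. *)
have -> : (fun w => G (Y w)) @^-1` `]-oo, a[ =
  \bigcup_(q : {ffun I -> rat})
    [set w | G (q2r q) + eucl (fun i => Y w i - q2r q i) < a].
  apply/seteqP; split => [w /=|w [q _] /=]; rewrite in_itv /=.
    (* Coordinatewise error [e] gives distance at most (|I|+1) e, a third of the gap a - G(Y w).
       That distance is paid twice, once by the Lipschitz bound and once as the added term, which
       stays below the gap. *)
    move=> Ga; pose e := (a - G (Y w)) / (#|I|.+1%:R *+ 3).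
    have e0 : 0 < e by rewrite divr_gt0 ?subr_gt0 // pmulrn_lgt0.
    have qP i : exists q : rat, `|Y w i - ratr q| < e.
      have [q] := @rat_in_itvoo R (Y w i - e) (Y w i + e) ltac:(lra).
      rewrite in_itv /= => /andP[q1 q2].
      by exists q; rewrite ltr_norml; apply/andP; split; lra.
    exists [ffun i => projT1 (cid (qP i))] => //=; set q := [ffun i => _].
    have de : eucl (fun i => Y w i - q2r q i) <= #|I|.+1%:R * e.
      apply: le_trans (eucl_le_sum _) _; rewrite -natr1 mulrDl mul1r.
      apply: ler_wpDr; first exact: ltW.
      rewrite -sum1_card natr_sum mulr_suml; apply: ler_sum => i _.
      by rewrite mul1r /q2r ffunE ltW // (projT2 (cid (qP i))).
    have := Glip (q2r q) (Y w).
    have -> : eucl (fun i => q2r q i - Y w i) = eucl (fun i => Y w i - q2r q i).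
      by rewrite /eucl; congr Num.sqrt; apply: eq_bigr => i _; rewrite -sqrrN opprB.
    have n0 : (#|I|.+1%:R : R) != 0 by rewrite pnatr_eq0.
    have ne : #|I|.+1%:R * e *+ 3 = a - G (Y w).
      by rewrite /e -mulrnAr -mulrnAl; field.
    have ea : 0 < a - G (Y w) by rewrite subr_gt0.
    rewrite ler_norml => /andP[_]; move: ne de; rewrite !mulrS mulr0n addr0.
    move: (_ * e) (eucl _) => x y; lra.
  have := Glip (Y w) (q2r q); rewrite ler_norml => /andP[_]; lra.
apply: countable_bigcupT_measurable => [|q]; first exact: countableP.
have mq : measurable_fun setT (fun w => G (q2r q) + eucl (fun i => Y w i - q2r q i)).
  apply: measurable_funD => //; rewrite /eucl.
  apply: (@measurableT_comp _ _ _ _ _ _ (@Num.sqrt R)) => //.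
    by apply: continuous_measurable_fun; exact: sqrt_continuous.
  apply: measurable_sum => i; apply: measurable_funX; apply: measurable_funB => //.
rewrite -[X in measurable X]setTI.
have -> : [set w | G (q2r q) + eucl (fun i => Y w i - q2r q i) < a]
  = (fun w => G (q2r q) + eucl (fun i => Y w i - q2r q i)) @^-1` `]-oo, a[.
  by apply/seteqP; split => w /=; rewrite in_itv.
exact: mq.
Qed.

Lemma lip1_hs_measurable (m k : nat) (Y : T -> 'M[R]_(m, k)) (F : 'M[R]_(m, k) -> R) :
  lip1_hs F -> (forall i j, measurable_fun setT (fun w => Y w i j)) ->
  measurable_fun setT (fun w => F (Y w)).
Proof.
move=> Flip mY; pose mx (x : 'I_m * 'I_k -> R) := (\matrix_(i, j) x (i, j) : 'M[R]_(m, k)).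
have -> : (fun w => F (Y w)) = (fun w => F (mx (mxvecf (Y w)))).
  by apply/funext => w; congr F; apply/matrixP => i j; rewrite !mxE.
apply: (@lip1_eucl_measurable _ (fun w => mxvecf (Y w)) (fun x => F (mx x))); last first.
  by move=> [i j]; exact: mY.
move=> x y; apply: le_trans (Flip _ _) _.
rewrite hsnormE le_eqVlt; apply/orP; left; apply/eqP; congr eucl.
by apply/funext => -[i j]; rewrite /mxvecf !mxE.
Qed.

End LipschitzMeasurable.

(** * Medians, second moments, concentration around the mean *)

Section Moments.
Context {R : realType} {d : measure_display} {T : measurableType d}.
Variable P : probability T R.

Lemma probability_bigcap_ge (F : (set T)^nat) (x : \bar R) :
  (forall k, measurable (F k)) -> nonincreasing_seq F ->
  (forall k, x <= P (F k))%E -> (x <= P (\bigcap_k F k))%E.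
Proof.
move=> mF niF xF.
have FP : (P \o F) k @[k --> \oo] --> P (\bigcap_k F k).
  apply: nonincreasing_cvg_mu => //; last exact: bigcapT_measurable.
  by rewrite (le_lt_trans (probability_le1 _ _)) ?ltry.
rewrite -(cvg_lim _ FP) //; apply: lime_ge; first by apply/cvg_ex; eexists; exact: FP.
exact: nearW.
Qed.

Lemma measurable_setle (X Y : T -> R) :
  measurable_fun setT X -> measurable_fun setT Y -> measurable [set w | (X w <= Y w)%R].
Proof.
move=> mX mY; have -> : [set w | (X w <= Y w)%R] = setT `&` (Y \- X) @^-1` `[0, +oo[.
  by rewrite setTI; apply/seteqP; split => w /=; rewrite in_itv /= andbT subr_ge0.
by apply: measurable_funB.
Qed.

Lemma measurable_setlt (X Y : T -> R) :
  measurable_fun setT X -> measurable_fun setT Y -> measurable [set w | (X w < Y w)%R].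
Proof.
move=> mX mY; have -> : [set w | (X w < Y w)%R] = setT `&` (Y \- X) @^-1` `]0, +oo[.
  by rewrite setTI; apply/seteqP; split => w /=; rewrite in_itv /= andbT subr_gt0.
by apply: measurable_funB.
Qed.

(** The concentration hypothesis yields nothing until a median is exhibited. The infimum of the x
    with P(X <= x) >= 1/2 is one: both inequalities hold at the points inf S + 1/k and inf S - 1/k
    and pass to the limit by continuity from above. *)
Lemma median_exists (X : T -> R) : measurable_fun setT X -> exists m, is_median P X m.
Proof.
move=> mX; pose S := [set x | ((1/2)%:E <= P [set w | (X w <= x)%R])%E].
have half0 : ~ ((1/2)%:E <= 0 :> \bar R)%E by rewrite lee_fin; lra.
have mle x : measurable [set w | (X w <= x)%R] by exact: measurable_setle.
have mlt x : measurable [set w | (x < X w)%R] by exact: measurable_setlt.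
have compl x : P [set w | (x < X w)%R] = (1 - P [set w | (X w <= x)%R])%E.
  rewrite -probability_setC //; congr (P _); apply/seteqP; split => w /=.
    by rewrite ltNge => /negP.
  by rewrite ltNge => /negP.
have gt_half x : ~ S x -> ((1/2)%:E <= P [set w | (x < X w)%R])%E.
  move=> /negP; rewrite -ltNge compl => Sx.
  have fP : P [set w | (X w <= x)%R] \is a fin_num by rewrite fin_num_measure.
  by move: Sx; rewrite -(fineK fP) -EFinB lte_fin lee_fin; lra.
(* Otherwise P(X > k) >= 1/2 for every k, while these events decrease to the empty set. The lower
   bound of [S] is obtained in the same way from X <= -k. *)
have S0 : S !=set0.
  apply: contrapT => S0; apply: half0.
  rewrite -(measure0 P) [in leRHS](_ : set0 = \bigcap_k [set w | (k%:R < X w)%R]).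
    apply: probability_bigcap_ge => // [i j ij|k].
      by apply/subsetPset => w /=; apply: le_lt_trans; rewrite ler_nat.
    by apply: gt_half => Sk; apply: S0; exists k%:R.
  apply/esym/seteqP; split => // w /(_ (Num.bound (X w)) I) /=.
  by rewrite ltNge => /negP; apply; rewrite ltW // unstable.ltr_bound.
have Slb : has_lbound S.
  apply: contrapT => Slb; apply: half0.
  rewrite -(measure0 P) [in leRHS](_ : set0 = \bigcap_k [set w | (X w <= - k%:R)%R]).
    apply: probability_bigcap_ge => // [i j ij|k].
      by apply/subsetPset => w /= /le_trans; apply; rewrite lerN2 ler_nat.
    apply: contrapT => Sk; apply: Slb; exists (- k%:R) => x Sx.
    rewrite leNgt; apply/negP => xk; apply: Sk; apply: (le_trans Sx).
    apply: le_measure; rewrite ?inE // => w /= /le_trans; apply; exact: ltW.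
  apply/esym/seteqP; split => // w /(_ (Num.bound (X w)) I) /=.
  by rewrite leNgt => /negP; apply; rewrite ltrNl unstable.ltrNbound.
have hS : has_inf S by [].
exists (inf S); split.
- rewrite (_ : [set w | _] = \bigcap_k [set w | (inf S - k.+1%:R^-1 < X w)%R]).
    apply: probability_bigcap_ge => // [i j ij|k].
      apply/subsetPset => w /=; apply: le_lt_trans.
      by rewrite lerB // lef_pV2 ?posrE // ler_nat.
    apply: gt_half => /(ge_inf Slb); rewrite leNgt => /negP; apply.
    by rewrite gtrBl invr_gt0.
  apply/seteqP; split => w /=.
    by move=> Xw k _ /=; apply: lt_le_trans Xw; rewrite gtrBl invr_gt0.
  move=> Xw; rewrite leNgt; apply/negP => Xm.
  have [k /=] := ltr_add_invr Xm.
  by rewrite -ltrBrDr ltNge => /negP; apply; apply/ltW/(Xw k I).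
- rewrite (_ : [set w | _] = \bigcap_k [set w | (X w <= inf S + k.+1%:R^-1)%R]).
    apply: probability_bigcap_ge => // [i j ij|k].
      apply/subsetPset => w /= /le_trans; apply.
      by rewrite lerD2l lef_pV2 ?posrE // ler_nat.
    have [x Sx xk] := @inf_adherent _ S k.+1%:R^-1 ltac:(by rewrite invr_gt0) hS.
    apply: (le_trans Sx); apply: le_measure; rewrite ?inE // => w /= /le_trans.
    by apply; exact: ltW.
  apply/seteqP; split => w /=.
    by move=> Xw k _ /=; apply: (le_trans Xw); rewrite lerDl invr_ge0.
  move=> Xw; rewrite leNgt; apply/negP => Xm.
  have [k /=] := ltr_add_invr Xm.
  by rewrite ltNge => /negP; apply; apply: (Xw k I).
Qed.

(** A layer-cake sum: X^2 is at most r^2 times the number of k >= 0 with k r^2 <= X^2, and the k-th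
    event has probability at most 2 e^(-k) <= 2 / 2^k. Summing over k gives the factor 4. *)
Lemma second_moment_of_tail (X : T -> R) (r : R) : measurable_fun setT X -> 0 < r ->
  (forall t, 0 < t -> (P [set w | (t <= `|X w|)%R] <= (2 * expR (- t ^+ 2 / r ^+ 2))%:E)%E) ->
  (\int[P]_w (X w ^+ 2)%:E <= (4 * r ^+ 2)%:E)%E.
Proof.
move=> mX r0 tailX; have r20 : 0 < r ^+ 2 by rewrite exprn_gt0.
pose A k := [set w | (k%:R * r ^+ 2 <= X w ^+ 2)%R].
have mA k : measurable (A k).
  by apply: measurable_setle => //; exact: measurable_funX.
have PA k : (P (A k) <= (2 * ((2 ^ k)%:R)^-1)%:E)%E.
  case: k => [|k].
    by rewrite expn0 invr1 mulr1 (le_trans (probability_le1 _ _)) // lee_fin ler1n.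
  have t0 : 0 < Num.sqrt k.+1%:R * r by rewrite mulr_gt0 // sqrtr_gt0.
  have -> : A k.+1 = [set w | (Num.sqrt k.+1%:R * r <= `|X w|)%R].
    rewrite /A; apply/funext => w /=; apply/propext.
    rewrite -[X in _ <-> is_true X](ler_pXn2r (n := 2)) ?nnegrE ?(ltW t0) //.
    by rewrite exprMn sqr_sqrtr // real_normK ?num_real.
  apply: le_trans (tailX _ t0) _; rewrite lee_fin ler_pM2l //.
  rewrite exprMn sqr_sqrtr // mulNr mulfK ?gt_eqF // expRN lef_pV2 ?posrE ?expR_gt0 //.
  rewrite -[k.+1%:R]mulr1 expRM_natl natrX ler_pXn2r ?nnegrE ?expR_ge0 //.
  exact: (expR_ge1Dx 1).
pose f k w := (r ^+ 2 * \1_(A k) w)%:E.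
have f0 k w : (0 <= f k w)%E.
  by rewrite lee_fin mulr_ge0 ?(ltW r20) // indicE ler0n.
have mf k : measurable_fun setT (f k).
  by apply/measurable_EFinP; apply: measurable_funM.
apply: (@le_trans _ _ (\int[P]_w \sum_(0 <= k <oo) f k w)%E).
  apply: ge0_le_integral => //.
  - by move=> w _; rewrite lee_fin sqr_ge0.
  - by apply/measurable_EFinP; exact: measurable_funX.
  - by apply: ge0_emeasurable_sum => // k w _ _; exact: f0.
  (* All k < N satisfy k r^2 <= X^2, so the first [N] terms already contribute N r^2 > X^2. *)
  move=> w _; pose N := (Num.truncn (X w ^+ 2 / r ^+ 2)).+1.
  apply: le_trans (nneseries_lim_ge N _) => [|k *]; last exact: f0.
  rewrite sumEFin lee_fin (eq_big_nat _ _ (F2 := fun=> r ^+ 2)) => [|k /andP[_ kN]].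
    rewrite sumr_const_nat subn0 -mulr_natl -ler_pdivrMr // ltW //.
    by rewrite truncnS_gt.
  rewrite indicE mem_set ?mulr1 //= /A /= -ler_pdivlMr //.
  rewrite -truncn_ge_nat ?divr_ge0 ?sqr_ge0 //.
rewrite integral_nneseries; [|by []|exact: mf|by move=> k w _; exact: f0].
(* The k-th integral is at most 4 r^2 / 2^(k+1), a geometric series of sum 4 r^2. *)
apply: le_trans (@epsilon_trick0 R (4 * r ^+ 2) (fun=> true) _); last first.
  by rewrite mulr_ge0 ?(ltW r20).
apply: lee_nneseries => [k *|k *]; first by apply: integral_ge0 => w _; exact: f0.
rewrite /f; under eq_integral do rewrite EFinM.
rewrite ge0_integralZl_EFin;
  [|by []|by move=> w _; rewrite lee_fin indicE ler0n|exact/measurable_EFinP|exact: ltW].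
rewrite integral_indic // setIT.
apply: (@le_trans _ _ ((r ^+ 2)%:E * (2 * ((2 ^ k)%:R)^-1)%:E)%E).
  by apply: lee_wpmul2l; [rewrite lee_fin ltW|exact: PA].
rewrite -EFinM lee_fin expnS natrM invfM le_eqVlt; apply/orP; left; apply/eqP.
by field; rewrite pnatr_eq0 expn_eq0.
Qed.

End Moments.

Section MeanConcentration.
Context {R : realType} {d : measure_display} {T : measurableType d}.
Variable P : probability T R.

Lemma expectationE (X : T -> R) : 'E_P[X]%E = (\int[P]_w (X w)%:E)%E.
Proof. by rewrite unlock. Qed.

Lemma integral_cst_prob (b : R) : (\int[P]_w b%:E = b%:E)%E.
Proof.
by rewrite -[RHS]mule1 -(probability_setT P); exact: (integral_cst P measurableT b%:E).
Qed.

Lemma ge0_le_integral_EFin (X Y : T -> R) :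
  measurable_fun setT X -> measurable_fun setT Y ->
  (forall w, 0 <= X w) -> (forall w, X w <= Y w) ->
  (\int[P]_w (X w)%:E <= \int[P]_w (Y w)%:E)%E.
Proof.
move=> mX mY X0 XY; apply: ge0_le_integral => //.
- by move=> w _; rewrite lee_fin.
- exact/measurable_EFinP.
- exact/measurable_EFinP.
- by move=> w _; rewrite lee_fin.
Qed.

Lemma ge0_integral_affine (X : T -> R) (a b : R) :
  measurable_fun setT X -> (forall w, 0 <= X w) -> 0 <= a -> 0 <= b ->
  (\int[P]_w (a * X w + b)%:E = a%:E * \int[P]_w (X w)%:E + b%:E)%E.
Proof.
move=> mX X0 a0 b0; under eq_integral do rewrite EFinD EFinM.
rewrite ge0_integralD //.
- rewrite ge0_integralZl_EFin //.
  + by rewrite integral_cst_prob.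
  + by move=> w _; rewrite lee_fin.
  + exact/measurable_EFinP.
- by move=> w _; rewrite -EFinM lee_fin mulr_ge0.
- by apply: emeasurable_funM => //; exact/measurable_EFinP.
Qed.

(* AM-GM: |x| <= x^2/(2 del) + del/2 *)
Lemma norm_moment_le (X : T -> R) (del : R) : measurable_fun setT X -> 0 < del ->
  (\int[P]_w (X w ^+ 2)%:E <= (del ^+ 2)%:E)%E ->
  (\int[P]_w (`|X w|)%:E <= del%:E)%E.
Proof.
move=> mX d0 Xd; have d2 : 0 <= (del *+ 2)^-1 by rewrite invr_ge0 mulrn_wge0 ?ltW.
have mX2 : measurable_fun setT (fun w => X w ^+ 2) by exact: measurable_funX.
apply: (@le_trans _ _ (\int[P]_w ((del *+ 2)^-1 * X w ^+ 2 + del / 2)%:E)%E).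
  apply: ge0_le_integral_EFin => //.
  - by apply: measurableT_comp.
  - by apply: measurable_funD => //; apply: measurable_funM.
  - move=> w; rewrite -[X w ^+ 2]real_normK ?num_real // -subr_ge0.
    have -> : (del *+ 2)^-1 * `|X w| ^+ 2 + del / 2 - `|X w|
        = (`|X w| - del) ^+ 2 / (del *+ 2) by field; rewrite gt_eqF.
    by rewrite divr_ge0 ?sqr_ge0 // mulrn_wge0 // ltW.
rewrite ge0_integral_affine //; last by rewrite divr_ge0 ?ltW.
  apply: (@le_trans _ _ ((del *+ 2)^-1%:E * (del ^+ 2)%:E + (del / 2)%:E)%E).
    by apply: leeD2r; apply: lee_wpmul2l; rewrite ?lee_fin.
  by rewrite -EFinM -EFinD lee_fin le_eqVlt; apply/orP; left; apply/eqP; field;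
    rewrite gt_eqF.
by move=> w; rewrite sqr_ge0.
Qed.

Lemma integrable_norm_lty (X : T -> R) (c : R) : measurable_fun setT X ->
  (\int[P]_w (`|X w|)%:E <= c%:E)%E -> P.-integrable setT (fun w => (X w)%:E).
Proof.
move=> mX Xc; apply/integrableP; split; first exact/measurable_EFinP.
exact: le_lt_trans Xc (ltry _).
Qed.

Lemma integrable_shift (X : T -> R) (m : R) : measurable_fun setT X ->
  P.-integrable setT (fun w => (X w - m)%:E) -> P.-integrable setT (fun w => (X w)%:E).
Proof.
move=> mX iX; have im := finite_measure_integrable_cst P m (@measurableT _ T).
have := integrableD measurableT iX im; apply: eq_integrable => // w _ /=.
by rewrite -EFinD subrK.
Qed.

(** |E X - m| <= E |X - m| <= del. The centre m is arbitrary: a median when the bound comes from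
    concentration, the value F(0) when it comes from the norm of the network output. *)
Lemma mean_near (X : T -> R) (m del : R) : measurable_fun setT X -> 0 < del ->
  (\int[P]_w ((X w - m) ^+ 2)%:E <= (del ^+ 2)%:E)%E ->
  P.-integrable setT (fun w => (X w)%:E) /\ `|fine 'E_P[X]%E - m| <= del.
Proof.
move=> mX d0 Xd.
have mXm : measurable_fun setT (fun w => X w - m) by exact: measurable_funB.
have Xm := norm_moment_le mXm d0 Xd.
have iXm := integrable_norm_lty mXm Xm.
have iX := integrable_shift mX iXm; split => //.
have im := finite_measure_integrable_cst P m (@measurableT _ T).
have fX := integrable_fin_num measurableT iX.
rewrite expectationE -lee_fin.
apply: (le_trans _ Xm).
have mE : measurable_fun setT (EFin \o (fun w => X w - m)) by exact/measurable_EFinP.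
apply: (le_trans _ (le_abse_integral P measurableT mE)) => /=.
rewrite integralB_EFin // integral_cst_prob.
by rewrite -[in leRHS](fineK fX) -EFinB.
Qed.

(** Mean and median differ by at most 2r. If t < 5r, the exponent t^2/(50 r^2) is at most 1/2 and
    the right side exceeds 1. If t >= 5r, then 2r <= t/2, and the tail around the median at t/2
    suffices. *)
Lemma mean_tail_of_median_tail (X : T -> R) (m r : R) : measurable_fun setT X -> 0 < r ->
  (forall t, 0 < t ->
    (P [set w | (t <= `|X w - m|)%R] <= (2 * expR (- t ^+ 2 / r ^+ 2))%:E)%E) ->
  forall t, 0 < t -> (P [set w | (t <= `|X w - fine 'E_P[X]%E|)%R]
    <= (2 * expR (- t ^+ 2 / (50 * r ^+ 2)))%:E)%E.
Proof.
move=> mX r0 tailX t t0; have r20 : 0 < r ^+ 2 by rewrite exprn_gt0.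
have mXm : measurable_fun setT (fun w => X w - m) by exact: measurable_funB.
have r2 : 0 < 2 * r by rewrite mulr_gt0.
have [_ Em] : P.-integrable setT (fun w => (X w)%:E) /\ `|fine 'E_P[X]%E - m| <= 2 * r.
  apply: mean_near => //; rewrite exprMn -natrX.
  exact: second_moment_of_tail.
set E := fine _ in Em *.
have mabs (c : R) s : measurable [set w | (s <= `|X w - c|)%R].
  apply: measurable_setle => //; apply: measurableT_comp => //.
  exact: measurable_funB.
have [tr|rt] := ltP t (5 * r).
  apply: (le_trans (probability_le1 _ _)); rewrite // lee_fin -ler_pdivrMl // mulr1.
  apply: le_trans (expR_ge1Dx _).
  have : t ^+ 2 <= 25 * r ^+ 2.
    by rewrite (_ : 25 = 5 ^+ 2 :> R) -?exprMn -?natrX // ler_pXn2r ?nnegrE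
      ?mulr_ge0 ?ltW.
  move=> t2; have : t ^+ 2 / (50 * r ^+ 2) <= 2^-1.
    rewrite ler_pdivrMr ?mulr_gt0 //; lra.
  rewrite mulNr; lra.
apply: (@le_trans _ _ (P [set w | (t / 2 <= `|X w - m|)%R])).
  apply: le_measure; rewrite ?inE // => w /= tX.
  have := ler_distD E (X w) m; rewrite ![`|E - m|]/= => _.
  have : `|X w - E| <= `|X w - m| + `|E - m|.
    by rewrite [`|E - m|]distrC; exact: ler_distD.
  lra.
apply: le_trans (tailX _ _) _; first by rewrite divr_gt0.
rewrite lee_fin ler_pM2l // ler_expR !mulNr lerN2 expr_div_n.
have -> : t ^+ 2 / 2 ^+ 2 / r ^+ 2 = t ^+ 2 / (4 * r ^+ 2) by field; rewrite gt_eqF.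
rewrite ler_pM2l ?exprn_gt0 // lef_pV2 ?posrE ?mulr_gt0 //; lra.
Qed.

End MeanConcentration.

(** * Lipschitz functions and linear forms of a subgaussian vector *)

Section SubgaussianVector.
Context {R : realType} {d : measure_display} {T : measurableType d}.
Variables (P : probability T R) (I : finType) (Y : T -> I -> R) (rho : R).
Hypotheses (rho0 : 0 < rho) (mY : random_vec Y) (sY : subgauss_conc P Y rho).

Lemma lip_rescale (g : (I -> R) -> R) (lam : R) : 0 < lam ->
  (forall x y, `|g x - g y| <= lam * eucl (fun i => x i - y i)) ->
  lip1_eucl (fun x => lam^-1 * g x).
Proof.
move=> lam0 glip x y; rewrite -mulrBr normrM gtr0_norm ?invr_gt0 //.
by rewrite ler_pdivrMl.
Qed.

Lemma lip_measurable (g : (I -> R) -> R) (lam : R) : 0 < lam ->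
  (forall x y, `|g x - g y| <= lam * eucl (fun i => x i - y i)) ->
  measurable_fun setT (fun w => g (Y w)).
Proof.
move=> lam0 /(lip_rescale lam0) Glip; have mg := lip1_eucl_measurable Glip mY.
have -> : (fun w => g (Y w)) = (fun w => lam * (lam^-1 * g (Y w))).
  by apply/funext => w; rewrite mulrA divff ?mul1r // gt_eqF.
exact: measurable_funM.
Qed.

Lemma subgauss_lip_median (g : (I -> R) -> R) (lam : R) : 0 < lam ->
  (forall x y, `|g x - g y| <= lam * eucl (fun i => x i - y i)) ->
  exists m, forall t, 0 < t ->
    (P [set w | (t <= `|g (Y w) - m|)%R] <= (2 * expR (- t ^+ 2 / (rho * lam) ^+ 2))%:E)%E.
Proof.
move=> lam0 glip; have Glip := lip_rescale lam0 glip.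
have [m med] := median_exists P (lip1_eucl_measurable Glip mY).
exists (lam * m) => t t0; have tl : 0 < t / lam by rewrite divr_gt0.
have E w : (t / lam <= `|lam^-1 * g (Y w) - m|) = (t <= `|g (Y w) - lam * m|).
  have -> : lam^-1 * g (Y w) - m = (g (Y w) - lam * m) / lam by field; rewrite gt_eqF.
  by rewrite normrM (@gtr0_norm _ lam^-1) ?invr_gt0 // ler_pM2r ?invr_gt0.
have := sY Glip med tl; congr (P _ <= _)%E.
  by apply/seteqP; split => w /=; rewrite E.
congr (_ * expR _)%:E; rewrite expr_div_n exprMn; field.
by rewrite !gt_eqF.
Qed.

Lemma subgauss_lip_moment (g : (I -> R) -> R) (lam : R) : 0 < lam ->
  (forall x y, `|g x - g y| <= lam * eucl (fun i => x i - y i)) ->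
  exists m, (\int[P]_w ((g (Y w) - m) ^+ 2)%:E <= ((2 * (rho * lam)) ^+ 2)%:E)%E.
Proof.
move=> lam0 glip; have [m tailm] := subgauss_lip_median lam0 glip.
exists m; rewrite exprMn -natrX; apply: second_moment_of_tail => //.
- by apply: measurable_funB => //; exact: lip_measurable glip.
- exact: mulr_gt0.
Qed.

Lemma subgauss_lip_integrable (g : (I -> R) -> R) (lam : R) : 0 < lam ->
  (forall x y, `|g x - g y| <= lam * eucl (fun i => x i - y i)) ->
  P.-integrable setT (fun w => (g (Y w))%:E).
Proof.
move=> lam0 glip; have [m gm] := subgauss_lip_moment lam0 glip.
have [] // := mean_near (lip_measurable lam0 glip) _ gm.
by rewrite !mulr_gt0.
Qed.

Lemma subgauss_lip_mean (g : (I -> R) -> R) (lam : R) : 0 < lam ->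
  (forall x y, `|g x - g y| <= lam * eucl (fun i => x i - y i)) ->
  forall t, 0 < t ->
    (P [set w | (t <= `|g (Y w) - fine 'E_P[fun w => g (Y w)]%E|)%R]
      <= (2 * expR (- t ^+ 2 / (50 * (rho * lam) ^+ 2)))%:E)%E.
Proof.
move=> lam0 glip; have [m tailm] := subgauss_lip_median lam0 glip.
apply: mean_tail_of_median_tail tailm; last exact: mulr_gt0.
exact: lip_measurable glip.
Qed.

(** The covariance bound: a linear form with coefficients a is |a|-Lipschitz, so concentration
    controls its second moment around some m, free of the dimension. Centering moves the bound from
    m to 0. *)
Lemma centered_dot_moment (a : I -> R) : centered P Y ->
  (\int[P]_w ((\sum_i a i * Y w i) ^+ 2)%:E <= (4 * rho ^+ 2 * \sum_i a i ^+ 2)%:E)%E.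
Proof.
move=> cY; rewrite -sqr_eucl.
have [/eucl_eq0 a0|an] := eqVneq (eucl a) 0.
  have dot0 w : \sum_i a i * Y w i = 0 by rewrite big1 // => i _; rewrite a0 mul0r.
  under eq_integral do rewrite dot0 expr0n /=.
  by rewrite integral0 lee_fin mulr_ge0 ?sqr_ge0 // mulr_ge0 ?sqr_ge0.
have a0 : 0 < eucl a by rewrite lt_def an eucl_ge0.
pose g (x : I -> R) := \sum_i a i * x i.
have glip x y : `|g x - g y| <= eucl a * eucl (fun i => x i - y i).
  rewrite /g -sumrB; under eq_bigr do rewrite -mulrBr.
  exact: eucl_dot_norm_le.
have mg := lip_measurable a0 glip.
have [m gm] := subgauss_lip_moment a0 glip.
have ig := subgauss_lip_integrable a0 glip.
have iY i : P.-integrable setT (fun w => (Y w i)%:E).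
  apply: (@subgauss_lip_integrable (fun x => x i) 1) => // x y.
  rewrite mul1r -(@ler_pXn2r _ 2) ?nnegrE ?eucl_ge0 // sqr_eucl real_normK ?num_real //.
  by rewrite (bigD1 i) //= lerDl sumr_ge0 // => j _; rewrite sqr_ge0.
have Eg : (\int[P]_w (g (Y w))%:E = 0)%E.
  rewrite /g; under eq_integral do rewrite -sumEFin; rewrite integral_sum //.
    rewrite big1 // => i _; under eq_integral do rewrite EFinM.
    by rewrite integralZl // -expectationE cY mule0.
  move=> i; have := integrableZl measurableT (a i) (iY i).
  by apply: eq_integrable => // w _; rewrite EFinM.
have mgm : measurable_fun setT (fun w => (g (Y w) - m) ^+ 2).
  by apply: measurable_funX; exact: measurable_funB.
have igm : P.-integrable setT (fun w => ((g (Y w) - m) ^+ 2)%:E).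
  apply/integrableP; split; first exact/measurable_EFinP.
  under eq_integral do rewrite abse_EFin ger0_norm ?sqr_ge0 //.
  exact: le_lt_trans gm (ltry _).
(* (g - m)^2 + 2 m g = g^2 + m^2 dominates g^2, and the cross term has integral 0. *)
apply: (@le_trans _ _ (\int[P]_w ((g (Y w) - m) ^+ 2 + (m *+ 2) * g (Y w))%:E)%E).
  apply: ge0_le_integral_EFin => //.
  - exact: measurable_funX.
  - by apply: measurable_funD => //; exact: measurable_funM.
  - by move=> w; rewrite sqr_ge0.
  - move=> w; rewrite -/(g (Y w)) -subr_ge0.
    rewrite (_ : _ - _ = m ^+ 2) ?sqr_ge0 //; ring.
under eq_integral do rewrite EFinD [X in (_ + X)%E]EFinM.
rewrite integralD //; last exact: integrableZl measurableT _ _ ig.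
rewrite integralZl // Eg mule0 adde0; apply: (le_trans gm).
by rewrite lee_fin !exprMn -natrX mulrA.
Qed.

Lemma centered_coord_moment (i : I) : centered P Y ->
  (\int[P]_w (Y w i ^+ 2)%:E <= (4 * rho ^+ 2)%:E)%E.
Proof.
move=> /(centered_dot_moment (fun j => (j == i)%:R)).
have sum1 (x : I -> R) : \sum_j (j == i)%:R * x j = x i.
  by rewrite (bigD1 i) //= eqxx mul1r big1 ?addr0 // => j /negPf ->; rewrite mul0r.
under eq_integral do rewrite sum1.
rewrite (bigD1 i) //= eqxx expr1n big1 ?addr0 ?mulr1 // => j /negPf ->.
by rewrite expr0n.
Qed.

End SubgaussianVector.

(** * Fubini for independent sigma-algebras *)

Section IndependentFubini.
Context {R : realType} {d : measure_display} {T : measurableType d}.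
Variable P : probability T R.

(** For fixed [B] both sides are finite measures in [A], the restriction of [P] to [B] and a
    multiple of [P]; agreeing on a pi-system, they agree on the sigma-algebra it generates. *)
Lemma indep_g_sigma_algebra (C : set (set T)) (B : set T) :
  C `<=` measurable -> setI_closed C -> C setT -> measurable B ->
  (forall A, C A -> (P (A `&` B) = P A * P B)%E) ->
  forall A, <<s C >> A -> (P (A `&` B) = P A * P B)%E.
Proof.
move=> mC CI CT mB CB A CA.
have PB0 : 0 <= fine (P B) by exact: fine_ge0.
have fPB : P B \is a fin_num by exact: fin_num_measure.
pose m1 := mrestr P mB; pose m2 := mscale (NngNum PB0) P.
have m12 : m1 A = m2 A.
  apply: (g_sigma_algebra_measure_unique C mC (fun=> setT)) => //.
  - by rewrite bigcup_const.
  - move=> E CE; rewrite /= /m1 /m2 /mrestr /mscale /= CB // fineK // muleC //.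
  - by move=> _; rewrite /m1 /= /mrestr /= setTI -ge0_fin_numE.
by move: m12; rewrite /m1 /m2 /mrestr /mscale /= fineK // muleC.
Qed.

Variables C1 C2 : set (set T).
Hypotheses (mC1 : C1 `<=` measurable) (mC2 : C2 `<=` measurable).
Hypothesis indep : forall A B, <<s C1 >> A -> <<s C2 >> B -> (P (A `&` B) = P A * P B)%E.

Notation T1 := (g_sigma_algebraType C1).
Notation T2 := (g_sigma_algebraType C2).

Lemma measurable_id_sub (C : set (set T)) : C `<=` measurable ->
  measurable_fun setT (fun w : T => w : g_sigma_algebraType C).
Proof.
move=> mC _ A mA; rewrite setTI.
exact: (smallest_sub (@sigma_algebra_measurable _ T) mC mA).
Qed.

Let m1 := measurable_id_sub mC1.
Let m2 := measurable_id_sub mC2.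

(* Independence of the sigma-algebras generated by C1 and C2 says that the image
   of P under the diagonal is a product measure on T1 * T2. *)
Lemma measurable_diag : measurable_fun setT (fun w : T => ((w, w) : T1 * T2)).
Proof. exact: measurable_fun_pair. Qed.

Let id1 : T -> T1 := fun w => w.
Let id2 : T -> T2 := fun w => w.
Let diag : T -> T1 * T2 := fun w => (w, w).

Let id1_mixin := isMeasurableFun.Build _ _ _ _ id1 m1.
Let id2_mixin := isMeasurableFun.Build _ _ _ _ id2 m2.
Let diag_mixin := isMeasurableFun.Build _ _ _ _ diag measurable_diag.
Let id1_mfun : {mfun T >-> T1} := HB.pack id1 id1_mixin.
Let id2_mfun : {mfun T >-> T2} := HB.pack id2 id2_mixin.
Let diag_mfun : {mfun T >-> (T1 * T2)%type} := HB.pack diag diag_mixin.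

Let P1 : probability T1 R := distribution P id1_mfun.
Let P2 : probability T2 R := distribution P id2_mfun.
Let P12 : probability (T1 * T2)%type R := distribution P diag_mfun.

Let P12E X : measurable X -> (P1 \x P2)%E X = P12 X.
Proof. by move=> mX; apply: product_measure_unique => // A B mA mB; exact: indep. Qed.

Lemma ge0_integral_indep (h : T1 * T2 -> \bar R) :
  measurable_fun setT h -> (forall z, 0 <= h z)%E ->
  (\int[P]_w h (w, w) = \int[P]_w \int[P]_w' h (w, w'))%E.
Proof.
move=> mh h0.
transitivity (\int[P12]_z h z)%E.
  by rewrite ge0_integral_distribution.
rewrite -(eq_measure_integral _ (fun X mX _ => P12E mX)) fubini_tonelli1 //.
rewrite ge0_integral_distribution //.
- apply: eq_integral => w _ /=; rewrite /fubini_F ge0_integral_distribution //.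
  exact: measurableT_comp.
- exact: measurable_fun_fubini_tonelli_F.
- by move=> w; apply: integral_ge0.
Qed.

(** Substitutes for conditional expectation: a bound on the inner integral, valid for each frozen
    first copy of w, is integrated over that copy. *)
Lemma integral_indep_le (h : T1 * T2 -> \bar R) (g : T -> \bar R) :
  measurable_fun setT h -> (forall z, 0 <= h z)%E -> measurable_fun setT g ->
  (forall w, \int[P]_w' h (w, w') <= g w)%E -> (\int[P]_w h (w, w) <= \int[P]_w g w)%E.
Proof.
move=> mh h0 mg hg; rewrite ge0_integral_indep //; apply: ge0_le_integral => //.
- by move=> w _; apply: integral_ge0.
- have -> : (fun w => \int[P]_w' h (w, w'))%E = fubini_F P2 h \o id1_mfun.
    apply/funext => w /=; rewrite /fubini_F ge0_integral_distribution //.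
    exact: measurableT_comp.
  by apply: measurableT_comp => //; exact: measurable_fun_fubini_tonelli_F.
Qed.

Lemma probability_indep_le (E : set (T1 * T2)) (p : R) :
  measurable E -> (forall w, P [set w' | E (w, w')] <= p%:E)%E ->
  (P [set w | E (w, w)] <= p%:E)%E.
Proof.
move=> mE Ep.
have mE' (e : T -> T1 * T2) : measurable_fun setT e -> measurable [set w | E (e w)].
  by move=> me; rewrite -[X in measurable X]setTI; exact: me.
have PE (e : T -> T1 * T2) : measurable_fun setT e ->
    (\int[P]_w (\1_E (e w))%:E = P [set w | E (e w)])%E.
  move=> me; have := integral_indic P measurableT (mE' e me); rewrite setIT => <-.
  by apply: eq_integral => w _; congr _%:E; rewrite !indicE.
rewrite -PE; last exact: measurable_diag.
rewrite -(integral_cst_prob P); apply: (integral_indep_le (h := fun z => (\1_E z)%:E)) => //.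
- exact/measurable_EFinP.
- by move=> w; rewrite (PE (fun w' => (w, w'))) //; exact: measurable_fun_pair.
Qed.

(** The signed counterpart of [ge0_integral_indep], needed to compare the mean of [F] after a layer
    with the mean of its conditional expectation. *)
Lemma integral_indep (h : T1 * T2 -> \bar R) :
  measurable_fun setT h -> P.-integrable setT (fun w => h (w, w)) ->
  (forall w, P.-integrable setT (fun w' => h (w, w'))) ->
  P.-integrable setT (fun w => \int[P]_w' h (w, w'))%E ->
  (\int[P]_w h (w, w) = \int[P]_w \int[P]_w' h (w, w'))%E.
Proof.
move=> mh ih iw iF.
have ih12 : P12.-integrable setT h by exact: integrable_pushforward.
have ih' : (P1 \x P2)%E.-integrable setT h.
  move/integrableP : ih12 => [_ ih12]; apply/integrableP; split => //.
  by rewrite (eq_measure_integral _ (fun X mX _ => P12E mX)).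
have FE w : fubini_F P2 h w = (\int[P]_w' h (w, w'))%E.
  rewrite /fubini_F integral_distribution; [by []| |exact: iw].
  exact: measurableT_comp.
transitivity (\int[P12]_z h z)%E; first by rewrite integral_distribution.
rewrite -(eq_measure_integral _ (fun X mX _ => P12E mX)) -integral12_prod_meas1 //.
rewrite integral_distribution //.
- by apply: eq_integral => w _; rewrite /= FE.
- exact: (measurable_fubini_F ih').
- by apply: eq_integrable iF => // w _; rewrite /= FE.
Qed.

End IndependentFubini.

(** * One layer with a fixed input *)

Section Subvector.
Context {R : realType} {d : measure_display} {T : measurableType d}.
Variables (P : probability T R) (I J : finType) (Y : T -> I -> R) (rho : R).

Lemma eucl_reindex_le (f : J -> I) (x : I -> R) : injective f ->
  eucl (fun j => x (f j)) <= eucl x.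
Proof.
move=> finj; rewrite -(@ler_pXn2r _ 2) ?nnegrE ?eucl_ge0 // !sqr_eucl.
rewrite -(big_imset (fun i => x i ^+ 2) (h := f) (A := J)) /=; last exact: in2W.
by rewrite [leRHS](bigID (mem (f @: J)%SET)) /= lerDl sumr_ge0 // => i _; rewrite sqr_ge0.
Qed.

Lemma subgauss_reindex (f : J -> I) : injective f -> subgauss_conc P Y rho ->
  subgauss_conc P (fun w j => Y w (f j)) rho.
Proof.
move=> finj sY G Glip; apply: (sY (fun x => G (fun j => x (f j)))) => x y.
exact: le_trans (Glip _ _) (eucl_reindex_le (fun i => x i - y i) finj).
Qed.

End Subvector.

(** The successor case of [Znet] with free dimensions. The two are convertible, so results on a
    single layer apply to [Znet] directly. *)
Definition layer_map {R : realType} {m k n : nat} (s : R -> R) (w : 'M[R]_(m, k))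
    (b : 'cV[R]_m) (Z : 'M[R]_(k, n)) : 'M[R]_(m, n) :=
  (Num.sqrt m%:R)^-1 *: map_mx s (w *m Z + b *m const_mx 1).

Lemma layer_map_measurable {R : realType} {d : measure_display} {T : measurableType d}
    (m k n : nat) (s : R -> R) (W : T -> 'M[R]_(m, k)) (B : T -> 'cV[R]_m)
    (Z : T -> 'M[R]_(k, n)) : measurable_fun setT s ->
  (forall i j, measurable_fun setT (fun w => W w i j)) ->
  (forall i, measurable_fun setT (fun w => B w i ord0)) ->
  (forall i j, measurable_fun setT (fun w => Z w i j)) ->
  forall i j, measurable_fun setT (fun w => layer_map s (W w) (B w) (Z w) i j).
Proof.
move=> ms mW mB mZ i j; under eq_fun do rewrite !mxE big_ord1 !mxE mulr1.
apply: measurable_funM => //; apply: measurableT_comp => //.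
apply: measurable_funD => //; apply: measurable_sum => l; exact: measurable_funM.
Qed.

Section Layer.
Context {R : realType} {d : measure_display} {T : measurableType d}.
Variables (P : probability T R) (m k n : nat).
Variables (W : T -> 'M[R]_(m, k)) (B : T -> 'cV[R]_m) (s : R -> R).
Variables (rho lam tau : R).
Hypotheses (m0 : (0 < m)%N) (n0 : (0 < n)%N) (rho0 : 0 < rho) (lam0 : 0 < lam).
Hypotheses (slip : lipschitz_R lam s) (s0 : `|s 0| <= tau).

Local Notation layer := (layer_map s).

Let mR : (0 : R) < m%:R. Proof. by rewrite ltr0n. Qed.
Let sm0 : (0 : R) < Num.sqrt m%:R. Proof. by rewrite sqrtr_gt0. Qed.
Let nR : (0 : R) < n%:R. Proof. by rewrite ltr0n. Qed.
Let sn0 : (0 : R) < Num.sqrt n%:R. Proof. by rewrite sqrtr_gt0. Qed.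

Lemma layer_sub_le (w1 w1' : 'M[R]_(m, k)) (b b' : 'cV[R]_m) (Z Z' : 'M[R]_(k, n)) :
  hsnorm (layer w1 b Z - layer w1' b' Z') <=
    lam / Num.sqrt m%:R *
      hsnorm (w1 *m Z + b *m const_mx 1 - (w1' *m Z' + b' *m const_mx 1)).
Proof.
rewrite /layer_map -scalerBr hsnormZ ger0_norm ?invr_ge0 ?sqrtr_ge0 // [lam / _]mulrC.
rewrite -mulrA ler_wpM2l ?invr_ge0 ?sqrtr_ge0 //.
by apply: hsnorm_map_lip => //; exact: ltW.
Qed.

Let wmx (y : ('I_m * 'I_k) + 'I_m -> R) : 'M[R]_(m, k) := \matrix_(i, j) y (inl (i, j)).
Let bmx (y : ('I_m * 'I_k) + 'I_m -> R) : 'cV[R]_m := \col_i y (inr i).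

Let wmxK w1 b : wmx (wbvec w1 b) = w1.
Proof. by apply/matrixP => i j; rewrite mxE. Qed.

Let bmxK w1 b : bmx (wbvec w1 b) = b.
Proof. by apply/matrixP => i j; rewrite (ord1 j) mxE. Qed.

Lemma hsnorm_const1 : hsnorm (const_mx 1 : 'M[R]_(1, n)) = Num.sqrt n%:R.
Proof.
rewrite /hsnorm; congr Num.sqrt; rewrite big_ord1.
under eq_bigr do rewrite mxE expr1n.
by rewrite sumr_const card_ord.
Qed.

(** The Lipschitz constant of the layer in [(W, B)] for a frozen input: an increment of [W] is
    multiplied by [Z], one of [B] by the all-ones row, whose norm is sqrt n. *)
Definition layer_lip (Z : 'M[R]_(k, n)) : R :=
  lam / Num.sqrt m%:R * (hsnorm Z + Num.sqrt n%:R).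

Lemma layer_lip_gt0 Z : 0 < layer_lip Z.
Proof. by rewrite mulr_gt0 ?divr_gt0 // ltr_wpDl // hsnorm_ge0. Qed.

Lemma layer_lipschitz (F : 'M[R]_(m, n) -> R) (Z : 'M[R]_(k, n)) : lip1_hs F ->
  forall x y, `|F (layer (wmx x) (bmx x) Z) - F (layer (wmx y) (bmx y) Z)|
    <= layer_lip Z * eucl (fun i => x i - y i).
Proof.
move=> Flip x y; apply: (le_trans (Flip _ _)); apply: (le_trans (layer_sub_le _ _ _ _ _ _)).
rewrite /layer_lip -[leRHS]mulrA ler_pM2l ?divr_gt0 //.
have -> : wmx x *m Z + bmx x *m const_mx 1 - (wmx y *m Z + bmx y *m const_mx 1)
   = (wmx x - wmx y) *m Z + (bmx x - bmx y) *m const_mx 1.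
  by rewrite !mulmxBl opprD addrACA.
apply: (le_trans (hsnormD _ _)); rewrite mulrDl lerD //.
  apply: (le_trans (hsnormM _ _)); rewrite mulrC ler_wpM2l ?hsnorm_ge0 // hsnormE.
  have inj : injective (inl : 'I_m * 'I_k -> ('I_m * 'I_k) + 'I_m) by move=> ? ? [].
  apply: le_trans (eucl_reindex_le (fun i => x i - y i) inj).
  by rewrite le_eqVlt; apply/orP; left; apply/eqP; congr eucl; apply/funext => -[i j];
    rewrite /mxvecf !mxE.
apply: (le_trans (hsnormM _ _)); rewrite hsnorm_const1 mulrC ler_wpM2l ?sqrtr_ge0 //.
have inj : injective (inr : 'I_m -> ('I_m * 'I_k) + 'I_m) by move=> ? ? [].
apply: le_trans (eucl_reindex_le (fun i => x i - y i) inj).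
rewrite -(@ler_pXn2r _ 2) ?nnegrE ?eucl_ge0 ?hsnorm_ge0 // sqr_eucl sqr_hsnorm.
by rewrite le_eqVlt; apply/orP; left; apply/eqP/eq_bigr => i _; rewrite big_ord1 !mxE.
Qed.

Hypotheses (mWB : random_vec (fun w => wbvec (W w) (B w))).
Hypotheses (sWB : subgauss_conc P (fun w => wbvec (W w) (B w)) rho).
Hypotheses (cWB : centered P (fun w => wbvec (W w) (B w))).

(** Evaluated at the output of the earlier layers, this is the conditional expectation of [F] given
    the past, realized as a function of a matrix. *)
Definition layer_mean (F : 'M[R]_(m, n) -> R) (Z : 'M[R]_(k, n)) : R :=
  fine 'E_P[fun w => F (layer (W w) (B w) Z)]%E.

Let FE (F : 'M[R]_(m, n) -> R) Z : (fun w => F (layer (W w) (B w) Z))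
  = (fun w => (fun y => F (layer (wmx y) (bmx y) Z)) (wbvec (W w) (B w))).
Proof. by apply/funext => w; rewrite wmxK bmxK. Qed.

Lemma layer_integrable (F : 'M[R]_(m, n) -> R) Z : lip1_hs F ->
  P.-integrable setT (fun w => (F (layer (W w) (B w) Z))%:E).
Proof.
move=> /layer_lipschitz Flip.
have := subgauss_lip_integrable rho0 mWB sWB (layer_lip_gt0 Z) (Flip Z).
by apply: eq_integrable => // w _; rewrite wmxK bmxK.
Qed.

Lemma layer_conc (F : 'M[R]_(m, n) -> R) Z t : lip1_hs F -> 0 < t ->
  (P [set w | (t <= `|F (layer (W w) (B w) Z) - layer_mean F Z|)%R]
     <= (2 * expR (- t ^+ 2 / (50 * (rho * layer_lip Z) ^+ 2)))%:E)%E.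
Proof.
move=> /layer_lipschitz Flip t0; rewrite /layer_mean FE.
have := subgauss_lip_mean rho0 mWB sWB (layer_lip_gt0 Z) (Flip Z) t0.
congr (P _ <= _)%E; apply/seteqP; split => w /=; by rewrite wmxK bmxK.
Qed.

Let mW i j : measurable_fun setT (fun w => W w i j).
Proof. exact: (mWB (inl (i, j))). Qed.

Let mB i : measurable_fun setT (fun w => B w i ord0).
Proof. exact: (mWB (inr i)). Qed.

Lemma row_moment (i : 'I_m) (a : 'I_k -> R) :
  (\int[P]_w ((\sum_j W w i j * a j) ^+ 2)%:E <= (4 * rho ^+ 2 * \sum_j a j ^+ 2)%:E)%E.
Proof.
pose f (j : 'I_k) : ('I_m * 'I_k) + 'I_m := inl (i, j).
have finj : injective f by move=> ? ? [].
have := @centered_dot_moment _ _ _ P _ (fun w j => wbvec (W w) (B w) (f j)) rho rho0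
  (fun j => mWB (f j)) (subgauss_reindex finj sWB) a (fun j => cWB (f j)).
by under eq_integral do under eq_bigr do rewrite mulrC.
Qed.

Lemma bias_moment (i : 'I_m) : (\int[P]_w ((B w i ord0) ^+ 2)%:E <= (4 * rho ^+ 2)%:E)%E.
Proof. exact: (centered_coord_moment rho0 mWB sWB (inr i) cWB). Qed.

(** Each entry of W D is a linear form in one row of [W] with a column of [D] as coefficients; there
    are m rows. The resulting sqrt m is cancelled by the normalization of the layer. *)
Lemma mulmx_moment (D : 'M[R]_(k, n)) :
  (\int[P]_w (hsnorm (W w *m D) ^+ 2)%:E <= (4 * rho ^+ 2 * m%:R * hsnorm D ^+ 2)%:E)%E.
Proof.
have mE i j : measurable_fun setT (fun w => (\sum_l W w i l * D l j) ^+ 2).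
  by apply: measurable_funX; apply: measurable_sum => l; exact: measurable_funM.
under eq_integral do rewrite sqr_hsnorm -sumEFin.
rewrite ge0_integral_sum //; last 2 first.
- move=> i; apply/measurable_EFinP; apply: measurable_sum => j.
  under eq_fun do rewrite mxE.
  exact: mE.
- by move=> i w _; rewrite lee_fin sumr_ge0 // => j _; rewrite sqr_ge0.
have -> : 4 * rho ^+ 2 * m%:R * hsnorm D ^+ 2
    = \sum_(i < m) \sum_(j < n) 4 * rho ^+ 2 * \sum_l D l j ^+ 2.
  rewrite sumr_const card_ord -mulr_sumr sqr_hsnorm exchange_big /=.
  by rewrite -[RHS]mulr_natl; ring.
rewrite -sumEFin; apply: lee_sum => i _.
under eq_integral do rewrite -sumEFin.
rewrite ge0_integral_sum //; last 2 first.
- move=> j; apply/measurable_EFinP; under eq_fun do rewrite mxE.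
  exact: mE.
- by move=> j w _; rewrite lee_fin sqr_ge0.
rewrite -sumEFin; apply: lee_sum => j _.
under eq_integral do rewrite mxE.
exact: row_moment.
Qed.

Lemma layer_mean_lip (F : 'M[R]_(m, n) -> R) Z Z' : lip1_hs F ->
  `|layer_mean F Z - layer_mean F Z'| <= 2 * rho * lam * hsnorm (Z - Z').
Proof.
move=> Flip; have i1 := layer_integrable Z Flip; have i2 := layer_integrable Z' Flip.
have f1 := integrable_fin_num measurableT i1.
have f2 := integrable_fin_num measurableT i2.
have mN : measurable_fun setT (fun w => hsnorm (W w *m (Z - Z'))).
  apply: lip1_hs_measurable => [|i j]; first exact: lip1_hs_hsnorm.
  under eq_fun do rewrite mxE; apply: measurable_sum => l; exact: measurable_funM.
have bound (del : R) : 0 < del -> 2 * rho * Num.sqrt m%:R * hsnorm (Z - Z') <= del ->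
    `|layer_mean F Z - layer_mean F Z'| <= lam / Num.sqrt m%:R * del.
  move=> d0 hd; rewrite /layer_mean -lee_fin !expectationE.
  have -> : (`|fine (\int[P]_w (F (layer (W w) (B w) Z))%:E)
      - fine (\int[P]_w (F (layer (W w) (B w) Z'))%:E)|%:E =
      `|\int[P]_w (F (layer (W w) (B w) Z) - F (layer (W w) (B w) Z'))%:E|)%E.
    by rewrite integralB_EFin // -[X in (X - _)%E](fineK f1) -[X in (_ - X)%E](fineK f2).
  have mF Z0 : measurable_fun setT (fun w => F (layer (W w) (B w) Z0)).
    by apply/measurable_EFinP; case/integrableP: (layer_integrable Z0 Flip).
  have mD := measurable_funB (mF Z) (mF Z').
  have mE : measurable_fun setT
      (EFin \o (fun w => F (layer (W w) (B w) Z) - F (layer (W w) (B w) Z'))).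
    exact/measurable_EFinP.
  apply: (le_trans (le_abse_integral P measurableT mE)) => /=.
  apply: (@le_trans _ _ (\int[P]_w
      (lam / Num.sqrt m%:R * `|hsnorm (W w *m (Z - Z'))| + 0)%:E)%E).
    apply: ge0_le_integral_EFin => //.
    - exact: measurableT_comp.
    - by apply: measurable_funD => //; apply: measurable_funM => //; exact: measurableT_comp.
    move=> w; rewrite addr0 (ger0_norm (hsnorm_ge0 _)).
    apply: (le_trans (Flip _ _)); apply: (le_trans (layer_sub_le _ _ _ _ _ _)).
    by rewrite mulmxBr opprD addrACA subrr addr0.
  have ls0 : 0 <= lam / Num.sqrt m%:R by rewrite divr_ge0 ?ltW.
  rewrite ge0_integral_affine; [|exact: measurableT_comp|by []|by []|by []].
  rewrite adde0 [leRHS]EFinM; apply: lee_wpmul2l; first by rewrite lee_fin.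
  apply: norm_moment_le => //; apply: (le_trans (mulmx_moment _)); rewrite lee_fin.
  have -> : 4 * rho ^+ 2 * m%:R * hsnorm (Z - Z') ^+ 2
      = (2 * rho * Num.sqrt m%:R * hsnorm (Z - Z')) ^+ 2.
    by have := sqr_sqrtr (ltW mR); rewrite !exprMn => ->; ring.
  by rewrite ler_pXn2r ?nnegrE ?(ltW d0) // !mulr_ge0 ?hsnorm_ge0 ?sqrtr_ge0 ?(ltW rho0).
(* [bound] asks for a positive [del], so a difference of norm 0 is treated by letting [del] tend to
   0. *)
have [D0|Dn] := eqVneq (hsnorm (Z - Z')) 0.
  apply/ler_addgt0Pr => e e0; rewrite D0 mulr0 add0r.
  have de : 0 < e / (lam / Num.sqrt m%:R) by rewrite !divr_gt0.
  have := bound _ de; rewrite D0 mulr0 ltW // => /(_ isT).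
  by rewrite mulrC divfK // gt_eqF // divr_gt0.
have Dp : 0 < hsnorm (Z - Z') by rewrite lt_def Dn hsnorm_ge0.
apply: le_trans (bound (2 * rho * Num.sqrt m%:R * hsnorm (Z - Z')) _ _) _ => //.
  by rewrite !mulr_gt0.
rewrite le_eqVlt; apply/orP; left; apply/eqP; field.
by rewrite gt_eqF.
Qed.

(** From |s(y)| <= tau + lam |y| follows s(x + b)^2 <= 2 tau^2 + 4 lam^2 (x^2 + b^2), and x and b
    have second moments at most 4 rho^2 |Z_j|^2 and 4 rho^2, with Z_j the j-th column of [Z]. The m
    rows cancel the factor 1/m. *)
Lemma layer_moment (Z : 'M[R]_(k, n)) : measurable_fun setT s -> 0 <= tau ->
  (\int[P]_w (hsnorm (layer (W w) (B w) Z) ^+ 2)%:E <=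
    (2 * tau ^+ 2 * n%:R + 16 * lam ^+ 2 * rho ^+ 2 * (hsnorm Z ^+ 2 + n%:R))%:E)%E.
Proof.
move=> ms tau0.
have mE i j : measurable_fun setT (fun w => layer (W w) (B w) Z i j).
  exact: (layer_map_measurable (Z := fun=> Z)).
under eq_integral do rewrite sqr_hsnorm -sumEFin.
rewrite ge0_integral_sum //; last 2 first.
- by move=> i; apply/measurable_EFinP; apply: measurable_sum => j; exact: measurable_funX.
- by move=> i w _; rewrite lee_fin sumr_ge0 // => j _; rewrite sqr_ge0.
have -> : 2 * tau ^+ 2 * n%:R + 16 * lam ^+ 2 * rho ^+ 2 * (hsnorm Z ^+ 2 + n%:R)
  = \sum_(i < m) \sum_(j < n) m%:R^-1 * (4 * lam ^+ 2 * (4 * rho ^+ 2 * \sum_l Z l j ^+ 2)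
     + (4 * lam ^+ 2 * (4 * rho ^+ 2) + 2 * tau ^+ 2)).
  rewrite sumr_const card_ord -mulr_sumr big_split /= -!mulr_sumr sumr_const card_ord.
  rewrite [\sum_(i < n) \sum_l _]exchange_big /= -sqr_hsnorm -mulr_natl mulrA.
  by rewrite -[in RHS](mulr_natl (_ + _) n); field; rewrite gt_eqF.
rewrite -sumEFin; apply: lee_sum => i _.
under eq_integral do rewrite -sumEFin.
rewrite ge0_integral_sum //; last 2 first.
- by move=> j; apply/measurable_EFinP; exact: measurable_funX.
- by move=> j w _; rewrite lee_fin sqr_ge0.
rewrite -sumEFin; apply: lee_sum => j _.
pose x w := \sum_l W w i l * Z l j.
have mx : measurable_fun setT x by apply: measurable_sum => l; exact: measurable_funM.
apply: (@le_trans _ _ (\int[P]_w (m%:R^-1 * (4 * lam ^+ 2 * x w ^+ 2 +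
    (4 * lam ^+ 2 * B w i ord0 ^+ 2 + 2 * tau ^+ 2)) + 0)%:E)%E).
  apply: ge0_le_integral_EFin => //.
  - exact: measurable_funX.
  - apply: measurable_funD => //; apply: measurable_funM => //; apply: measurable_funD.
      by apply: measurable_funM => //; exact: measurable_funX.
    by apply: measurable_funD => //; apply: measurable_funM => //; exact: measurable_funX.
  - by move=> w; rewrite sqr_ge0.
  move=> w; rewrite !mxE big_ord1 !mxE mulr1 -/(x w) exprMn exprVn sqr_sqrtr ?(ltW mR) //.
  rewrite addr0 ler_pM2l ?invr_gt0 //; set b := B w i ord0.
  have h1 : `|s (x w + b)| <= tau + lam * `|x w + b|.
    rewrite -[s (x w + b)](subrK (s 0)) addrC; apply: (le_trans (ler_normD _ _)).
    by rewrite lerD //; apply: (le_trans (slip _ _)); rewrite subr0.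
  have h2 : s (x w + b) ^+ 2 <= (tau + lam * `|x w + b|) ^+ 2.
    rewrite -[leLHS]real_normK ?num_real // ler_pXn2r ?nnegrE //.
    by rewrite addr_ge0 // mulr_ge0 // ltW.
  apply: (le_trans h2); rewrite -subr_ge0.
  have := real_normK (num_real (x w + b)); move: (`|x w + b|) => y yE.
  (* The difference of the two sides as a sum of squares, up to a last term that vanishes because y
     = |x + b|. *)
  rewrite (_ : _ - _ = (tau - lam * y) ^+ 2 + 2 * lam ^+ 2 * (x w - b) ^+ 2
     + 2 * lam ^+ 2 * ((x w + b) ^+ 2 - y ^+ 2)); last by ring.
  by rewrite yE subrr mulr0 addr0 addr_ge0 ?sqr_ge0 // mulr_ge0 ?sqr_ge0 // mulr_ge0 ?sqr_ge0.
have l0 : 0 <= 4 * lam ^+ 2 by rewrite mulr_ge0 ?sqr_ge0.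
have t0 : 0 <= 2 * tau ^+ 2 by rewrite mulr_ge0 ?sqr_ge0.
have mb : measurable_fun setT (fun w => 4 * lam ^+ 2 * B w i ord0 ^+ 2 + 2 * tau ^+ 2).
  by apply: measurable_funD => //; apply: measurable_funM => //; exact: measurable_funX.
have mx2 : measurable_fun setT (fun w => 4 * lam ^+ 2 * x w ^+ 2).
  by apply: measurable_funM => //; exact: measurable_funX.
have b0 w : 0 <= 4 * lam ^+ 2 * B w i ord0 ^+ 2 + 2 * tau ^+ 2.
  by rewrite addr_ge0 // mulr_ge0 ?sqr_ge0.
have x0 w : 0 <= 4 * lam ^+ 2 * x w ^+ 2 by rewrite mulr_ge0 ?sqr_ge0.
rewrite ge0_integral_affine ?invr_ge0 ?ler0n //; last 2 first.
- exact: measurable_funD.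
- by move=> w; rewrite addr_ge0.
rewrite adde0 [leRHS]EFinM; apply: lee_wpmul2l; first by rewrite lee_fin invr_ge0 ler0n.
under eq_integral do rewrite EFinD.
rewrite ge0_integralD //; last 4 first.
- by move=> w _; rewrite lee_fin.
- exact/measurable_EFinP.
- by move=> w _; rewrite lee_fin.
- exact/measurable_EFinP.
rewrite EFinD; apply: leeD.
  under eq_integral do rewrite EFinM.
  rewrite ge0_integralZl_EFin //.
  - rewrite [leRHS]EFinM; apply: lee_wpmul2l; first by rewrite lee_fin.
    exact: row_moment.
  - by move=> w _; rewrite lee_fin sqr_ge0.
  - by apply/measurable_EFinP; exact: measurable_funX.
rewrite ge0_integral_affine //; [|exact: measurable_funX|by move=> w; rewrite sqr_ge0].
rewrite [leRHS]EFinD; apply: leeD2r; rewrite [leRHS]EFinM.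
by apply: lee_wpmul2l; [rewrite lee_fin|exact: bias_moment].
Qed.

End Layer.

(** * The model: past and last layer *)

Section SigmaGen.
Context {R : realType} {d : measure_display} {T : measurableType d} {I : finType}.
Implicit Type Y : T -> I -> R.

Definition coord_sets Y : set (set T) :=
  [set E | exists (i : I) (A : set R), measurable A /\ E = (fun w => Y w i) @^-1` A].

Lemma coord_sets_measurable Y : random_vec Y -> coord_sets Y `<=` measurable.
Proof. by move=> mY _ [i [A [mA ->]]]; rewrite -[X in measurable X]setTI; exact: mY. Qed.

Lemma sigma_gen_measurable Y : random_vec Y -> sigma_gen Y `<=` measurable.
Proof.
move=> mY; apply: smallest_sub; first exact: sigma_algebra_measurable.
exact: coord_sets_measurable.
Qed.

Lemma sigma_genT Y : sigma_gen Y setT.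
Proof. exact: (@measurableT _ (g_sigma_algebraType (coord_sets Y))). Qed.

Lemma sigma_genI Y : setI_closed (sigma_gen Y).
Proof. exact: (@measurableI _ (g_sigma_algebraType (coord_sets Y))). Qed.

Lemma sigma_gen_preimage Y i A : measurable A -> sigma_gen Y ((fun w => Y w i) @^-1` A).
Proof. by move=> mA; apply: sub_sigma_algebra; exists i, A. Qed.

End SigmaGen.
Arguments sigma_genT {R d T I} Y.
Arguments sigma_gen_preimage {R d T I} Y i [A] mA.

Lemma lipschitz_measurable {R : realType} (lam : R) (s : R -> R) :
  0 < lam -> lipschitz_R lam s -> measurable_fun setT s.
Proof.
move=> lam0 slip.
apply: (@lip_measurable _ _ _ 'I_1 (fun x _ => x) _ (fun y => s (y ord0)) lam) => // x y.
by rewrite /eucl big_ord1 sqrtr_sqr; exact: slip.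
Qed.

Section Past.
Context {R : realType} {d : measure_display} {T : measurableType d}.
Variables (ns : nat -> nat) (n : nat) (sigma : nat -> R -> R).
Variables (X : T -> 'M[R]_(ns 0%N, n)) (W : forall l : nat, T -> 'M[R]_(ns l.+1, ns l)).
Variables (B : forall l : nat, T -> 'cV[R]_(ns l.+1)).

(* A pi-system generating the sigma-algebra of the input and the layers before L. *)
Definition past_sets (L : nat) : set (set T) :=
  [set A | exists (E0 : set T) (E : nat -> set T),
     [/\ sigma_gen (fun w => mxvecf (X w)) E0,
         forall l, (l < L)%N -> sigma_gen (fun w => wbvec (W l w) (B l w)) (E l) &
         A = E0 `&` \bigcap_(l in `I_L) E l]].

Lemma past_setsT L : past_sets L setT.
Proof.
exists setT, (fun=> setT); split => [|l _|]; try exact: sigma_genT.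
by rewrite setTI; apply/esym/seteqP; split.
Qed.

Lemma past_setsI L : setI_closed (past_sets L).
Proof.
move=> _ _ [E0 [E [hE0 hE ->]]] [E0' [E' [hE0' hE' ->]]].
exists (E0 `&` E0'), (fun l => E l `&` E' l); split; first exact: sigma_genI.
  by move=> l lL; apply: sigma_genI; [exact: hE|exact: hE'].
by rewrite bigcapI setIACA.
Qed.

Lemma past_sets_input L E0 : sigma_gen (fun w => mxvecf (X w)) E0 -> past_sets L E0.
Proof.
move=> hE0; exists E0, (fun=> setT); split => // [l _|]; first exact: sigma_genT.
by rewrite (_ : \bigcap_(_ in _) _ = setT) ?setIT //; apply/seteqP; split.
Qed.

Lemma past_sets_layer L l E : (l < L)%N ->
  sigma_gen (fun w => wbvec (W l w) (B l w)) E -> past_sets L E.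
Proof.
move=> lL hE; exists setT, (fun l' => if l' == l then E else setT); split.
- exact: sigma_genT.
- by move=> l' _; case: eqVneq => [->|_]; [exact: hE|exact: sigma_genT].
rewrite setTI; apply/seteqP; split => [w Ew l' _|w /(_ l lL)]; last by rewrite /= eqxx.
by rewrite /=; case: eqVneq.
Qed.

Lemma past_sets_measurable L : random_vec (fun w => mxvecf (X w)) ->
  (forall l, (l < L)%N -> random_vec (fun w => wbvec (W l w) (B l w))) ->
  past_sets L `<=` measurable.
Proof.
move=> mX mWB _ [E0 [E [hE0 hE ->]]]; apply: measurableI.
  exact: sigma_gen_measurable mX _ hE0.
by apply: bigcap_measurableType => l lL; exact: sigma_gen_measurable (mWB _ lL) _ (hE _ lL).
Qed.

Lemma Znet_measurable L :
  (forall i j, measurable_fun setT (fun w => X w i j)) ->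
  (forall l, (l < L)%N -> forall i j, measurable_fun setT (fun w => W l w i j)) ->
  (forall l, (l < L)%N -> forall i, measurable_fun setT (fun w => B l w i ord0)) ->
  (forall l, (l < L)%N -> measurable_fun setT (sigma l)) ->
  forall i j, measurable_fun setT
    (fun w => Znet sigma (X w) (fun l => W l w) (fun l => B l w) L i j).
Proof.
move=> mX; elim: L => [|L IH] mW mB ms i j.
  under eq_fun do rewrite /= mxE.
  exact: measurable_funM.
apply: (layer_map_measurable (Z := fun w => Znet _ _ _ _ L)).
- exact: ms.
- exact: mW.
- exact: mB.
- by apply: IH => l lL; [apply: mW|apply: mB|apply: ms]; exact: leq_trans lL _.
Qed.

End Past.

Section Model.
Context {R : realType} {d : measure_display} {T : measurableType d}.
Variables (P : probability T R) (L : nat) (rho lam tau alpha eta : R).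
Variables (ns : nat -> nat) (n : nat) (sigma : nat -> R -> R).
Variables (X : T -> 'M[R]_(ns 0%N, n)) (W : forall l : nat, T -> 'M[R]_(ns l.+1, ns l)).
Variables (B : forall l : nat, T -> 'cV[R]_(ns l.+1)).
Hypothesis lam0 : 0 < lam.

Local Notation Z l w := (Znet sigma (X w) (fun k => W k w) (fun k => B k w) l).

Lemma model_ok_Znet_measurable : model_ok L rho lam tau alpha eta P sigma X W B ->
  forall i j, measurable_fun setT (fun w => Z L w i j).
Proof.
move=> [_ [mX mWB] _ _ [_ sig _ _]]; apply: Znet_measurable.
- by move=> i j; exact: (mX (i, j)).
- by move=> l lL i j; exact: (mWB l lL (inl (i, j))).
- by move=> l lL i; exact: (mWB l lL (inr i)).
- by move=> l lL; apply: lipschitz_measurable lam0 _; exact: (sig l lL).1.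
Qed.

Hypothesis ok : model_ok L.+1 rho lam tau alpha eta P sigma X W B.

(** Isolates the last factor of the product formula, which turns joint independence into
    independence of past and last layer. *)
Lemma model_ok_indep E0 (E : nat -> set T) F :
  sigma_gen (fun w => mxvecf (X w)) E0 ->
  (forall l, (l < L)%N -> sigma_gen (fun w => wbvec (W l w) (B l w)) (E l)) ->
  sigma_gen (fun w => wbvec (W L w) (B L w)) F ->
  fine (P ((E0 `&` \bigcap_(l in `I_L) E l) `&` F)) =
    (fine (P E0) * \prod_(l < L) fine (P (E l))) * fine (P F).
Proof.
move=> hE0 hE hF; case: ok => _ _ ind _ _.
pose E' l := if (l < L)%N then E l else F.
have hE' l : (l < L.+1)%N -> sigma_gen (fun w => wbvec (W l w) (B l w)) (E' l).
  rewrite ltnS leq_eqVlt /E' => /orP[/eqP ->|lL]; first by rewrite ltnn.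
  by rewrite lL; exact: hE.
have := ind E0 E' hE0 hE'; rewrite big_ord_recr /= /E' ltnn mulrA.
have -> : \prod_(i < L) fine (P (if (i < L)%N then E i else F)) = \prod_(l < L) fine (P (E l)).
  by apply: eq_bigr => i _; rewrite ltn_ord.
move=> <-; congr (fine (P _)); rewrite -setIA; congr (_ `&` _).
apply/seteqP; split => [w [Ew Fw] l /= lL|w Ew].
  by case: ifPn => [/Ew //|].
split; last by have := Ew L (ltnSn L); rewrite /= ltnn.
by move=> l /= lL; have := Ew l (leqW lL); rewrite /= lL.
Qed.

Lemma model_ok_pred : model_ok L rho lam tau alpha eta P sigma X W B.
Proof.
case: ok => [[n0 nsp] [mX mWB] _ [sX sWB] [[cX cWB] sig al et]].
split.
- by split => // l lL; apply: nsp; exact: leqW.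
- by split => // l lL; apply: mWB; exact: leqW.
(* The product formula for the shorter network is the one for the longer network with the sure event
   at the last layer. *)
- move=> E0 E hE0 hE; have := model_ok_indep hE0 hE (sigma_genT _).
  by rewrite setIT probability_setT mulr1.
- by split => // l lL; apply: sWB; exact: leqW.
split.
- by split => // l lL; apply: cWB; exact: leqW.
- by move=> l lL; apply: sig; exact: leqW.
- by move=> l /andP[l1 lL]; apply: al; rewrite l1 leqW.
- exact: et.
Qed.

Local Notation C1 := (past_sets X W B L).
Local Notation C2 := (coord_sets (fun w => wbvec (W L w) (B L w))).
Local Notation T1 := (g_sigma_algebraType C1).
Local Notation T2 := (g_sigma_algebraType C2).

Lemma model_past_measurable : C1 `<=` measurable.
Proof.
case: ok => [_ [mX mWB] _ _ _]; apply: past_sets_measurable => // l lL.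
by apply: mWB; exact: leqW.
Qed.

Lemma model_last_measurable : C2 `<=` measurable.
Proof. by case: ok => [_ [_ mWB] _ _ _]; apply: coord_sets_measurable; exact: mWB. Qed.

(** The product formula with and without the last event gives independence on the pi-system
    [past_sets], which then extends to the generated sigma-algebra. *)
Lemma model_past_indep A F : <<s C1 >> A -> <<s C2 >> F -> (P (A `&` F) = P A * P F)%E.
Proof.
move=> CA CF.
have mF : measurable F.
  exact: (smallest_sub (@sigma_algebra_measurable _ T) model_last_measurable CF).
apply: (indep_g_sigma_algebra model_past_measurable (@past_setsI _ _ _ _ _ _ _ _ _)
  (past_setsT _ _ _ _) mF) CA => _ [E0 [E [hE0 hE ->]]].
have mE0 : measurable (E0 `&` \bigcap_(l in `I_L) E l).
  by apply: model_past_measurable; exists E0, E.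
have PE0 := model_ok_indep hE0 hE (sigma_genT _).
rewrite setIT probability_setT mulr1 in PE0.
have PE := model_ok_indep hE0 hE CF; rewrite -PE0 in PE.
rewrite -[LHS]fineK ?fin_num_measure //; last exact: measurableI.
by rewrite PE EFinM !fineK // fin_num_measure.
Qed.

(** Measurability with respect to the smaller sigma-algebra of the past is what allows [Z L] to be
    frozen while the last layer is averaged. *)
Lemma past_Znet_measurable i j : measurable_fun setT (fun w : T1 => Z L w i j).
Proof.
case: ok => [_ _ _ _ [_ sig _ _]].
apply: (@Znet_measurable _ _ T1).
- move=> i' j' _ U mU; rewrite setTI; apply: sub_sigma_algebra.
  by apply: past_sets_input; exact: (sigma_gen_preimage _ (i', j') mU).
- move=> l lL i' j' _ U mU; rewrite setTI; apply: sub_sigma_algebra.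
  apply: (@past_sets_layer _ _ _ _ _ X W B L l _ lL).
  exact: (sigma_gen_preimage (fun w => wbvec (W l w) (B l w)) (inl (i', j')) mU).
- move=> l lL i' _ U mU; rewrite setTI; apply: sub_sigma_algebra.
  apply: (@past_sets_layer _ _ _ _ _ X W B L l _ lL).
  exact: (sigma_gen_preimage (fun w => wbvec (W l w) (B l w)) (inr i') mU).
- by move=> l lL; apply: lipschitz_measurable lam0 _; exact: (sig l (leqW lL)).1.
Qed.

Lemma last_W_measurable i j : measurable_fun setT (fun w : T2 => W L w i j).
Proof.
move=> _ U mU; rewrite setTI; apply: sub_sigma_algebra.
by exists (inl (i, j)), U.
Qed.

Lemma last_B_measurable i : measurable_fun setT (fun w : T2 => B L w i ord0).
Proof.
move=> _ U mU; rewrite setTI; apply: sub_sigma_algebra.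
by exists (inr i), U.
Qed.

(** Past and last layer are read off different copies of w; on the diagonal this function is the
    network output at depth L+1. *)
Lemma joint_layer_measurable i j : measurable_fun setT (fun z : T1 * T2 =>
  layer_map (sigma L) (W L z.2) (B L z.2) (Z L z.1) i j).
Proof.
case: ok => [_ _ _ _ [_ sig _ _]].
apply: layer_map_measurable.
- by apply: lipschitz_measurable lam0 _; exact: (sig L (ltnSn L)).1.
- by move=> i' j'; apply: measurableT_comp (last_W_measurable i' j') _.
- by move=> i'; apply: measurableT_comp (last_B_measurable i') _.
- by move=> i' j'; apply: measurableT_comp (past_Znet_measurable i' j') _.
Qed.

End Model.

(** * Induction on the depth *)

Section Moment.
Context {R : realType}.

(** [C] is chosen before [alpha], [eta] and all dimensions: the normalization averages over the rows
    at every layer, so the second moment per column stays bounded. *)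
Lemma Znet_moment (L : nat) (rho lam tau : R) : 0 < rho -> 0 < lam -> 0 <= tau ->
  exists C : R, 0 < C /\
  forall (alpha eta : R) (d : measure_display) (T : measurableType d)
    (P : probability T R) (ns : nat -> nat) (n : nat) (sigma : nat -> R -> R)
    (X : T -> 'M[R]_(ns 0%N, n)) (W : forall l : nat, T -> 'M[R]_(ns l.+1, ns l))
    (B : forall l : nat, T -> 'cV[R]_(ns l.+1)),
  model_ok L rho lam tau alpha eta P sigma X W B ->
  (\int[P]_w (hsnorm (Znet sigma (X w) (fun l => W l w) (fun l => B l w) L) ^+ 2)%:E
    <= (C * n%:R)%:E)%E.
Proof.
move=> rho0 lam0 tau0; elim: L => [|L [C [C0 IH]]].
  exists (4 * rho ^+ 2); split; first by rewrite mulr_gt0 ?exprn_gt0.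
  move=> alpha eta d T P ns n sigma X W B [[_ ns0] [mX _] _ [sX _] [[cX _] _ _ _]].
  have n0R : (0 : R) < (ns 0%N)%:R by rewrite ltr0n ns0.
  have mXij i j : measurable_fun setT (fun w => X w i j ^+ 2).
    by apply: measurable_funX; exact: (mX (i, j)).
  have hE w : hsnorm (Znet sigma (X w) (fun l => W l w) (fun l => B l w) 0) ^+ 2
      = (ns 0%N)%:R^-1 * \sum_i \sum_j X w i j ^+ 2 + 0.
    rewrite hsnormZ exprMn sqr_hsnorm real_normK ?num_real // exprVn.
    by rewrite sqr_sqrtr ?(ltW n0R) // addr0.
  under eq_integral do rewrite hE.
  rewrite ge0_integral_affine ?invr_ge0 ?ler0n //; last 2 first.
  - by apply: measurable_sum => i; apply: measurable_sum => j; exact: mXij.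
  - by move=> w; do 2! apply: sumr_ge0 => ? _; rewrite sqr_ge0.
  have -> : 4 * rho ^+ 2 * n%:R = (ns 0%N)%:R^-1 * \sum_(i < ns 0%N) \sum_(j < n) 4 * rho ^+ 2.
    rewrite !sumr_const !card_ord -[_ *+ ns 0%N]mulr_natr -[_ *+ n]mulr_natr; field.
    by rewrite gt_eqF.
  rewrite adde0 [leRHS]EFinM; apply: lee_wpmul2l; first by rewrite lee_fin invr_ge0 ler0n.
  under eq_integral do rewrite -sumEFin.
  rewrite ge0_integral_sum //; last 2 first.
  - by move=> i; apply/measurable_EFinP; apply: measurable_sum => j; exact: mXij.
  - by move=> i w _; rewrite lee_fin sumr_ge0 // => j _; rewrite sqr_ge0.
  rewrite -sumEFin; apply: lee_sum => i _.
  under eq_integral do rewrite -sumEFin.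
  rewrite ge0_integral_sum //; last 2 first.
  - by move=> j; apply/measurable_EFinP; exact: mXij.
  - by move=> j w _; rewrite lee_fin sqr_ge0.
  rewrite -sumEFin; apply: lee_sum => j _.
  exact: (centered_coord_moment rho0 mX sX (i, j) cX).
(* The bound of [layer_moment] after averaging |Z_L|^2 <= C n. *)
exists (2 * tau ^+ 2 + 16 * lam ^+ 2 * rho ^+ 2 * (C + 1)); split.
  by rewrite ltr_wpDl ?mulr_ge0 ?sqr_ge0 // !mulr_gt0 ?exprn_gt0 // addr_gt0.
move=> alpha eta d T P ns n sigma X W B ok.
have {}IH := IH _ _ _ _ _ _ _ _ _ _ _ (model_ok_pred ok).
have mZ := model_ok_Znet_measurable lam0 (model_ok_pred ok).
have jm := joint_layer_measurable lam0 ok.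
have [[n0 nsp] [mX mWB] _ [sX sWB] [[cX cWB] sig _ _]] := ok.
have [sl s0] := sig L (ltnSn L).
pose Z w := Znet sigma (X w) (fun l => W l w) (fun l => B l w) L.
pose c := 16 * lam ^+ 2 * rho ^+ 2.
have c0 : 0 <= c by rewrite mulr_ge0 ?sqr_ge0 // mulr_ge0 ?sqr_ge0.
have t0 : 0 <= 2 * tau ^+ 2 by rewrite mulr_ge0 ?sqr_ge0.
have mZ2 : measurable_fun setT (fun w => hsnorm (Z w) ^+ 2).
  by apply: measurable_funX; apply: lip1_hs_measurable => //; exact: lip1_hs_hsnorm.
have b0 : 0 <= 2 * tau ^+ 2 * n%:R + c * n%:R by rewrite addr_ge0 // mulr_ge0 ?ler0n.
apply: (@le_trans _ _ (\int[P]_w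
    (c * hsnorm (Z w) ^+ 2 + (2 * tau ^+ 2 * n%:R + c * n%:R))%:E)%E).
  apply: (integral_indep_le (model_past_measurable ok) (model_last_measurable ok)
    (model_past_indep ok) (h := fun z => (hsnorm (layer_map (sigma L) (W L z.2) (B L z.2)
       (Znet sigma (X z.1) (fun l => W l z.1) (fun l => B l z.1) L)) ^+ 2)%:E)).
  - apply/measurable_EFinP; apply: measurable_funX.
    by apply: lip1_hs_measurable => //; exact: lip1_hs_hsnorm.
  - by move=> z; rewrite lee_fin sqr_ge0.
  - apply/measurable_EFinP; apply: measurable_funD => //; exact: measurable_funM.
  - move=> w /=.
    have := layer_moment (nsp L.+1 (leqnn _)) rho0 lam0 sl s0
      (mWB L (ltnSn L)) (sWB L (ltnSn L)) (cWB L (ltnSn L)) (Z w)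
      (lipschitz_measurable lam0 sl) tau0.
    move=> /le_trans; apply; rewrite lee_fin -/c le_eqVlt; apply/orP; left; apply/eqP; ring.
rewrite ge0_integral_affine //; last by move=> w; rewrite sqr_ge0.
apply: (@le_trans _ _ (c%:E * (C * n%:R)%:E + (2 * tau ^+ 2 * n%:R + c * n%:R)%:E)%E).
  by apply: leeD2r; apply: lee_wpmul2l; rewrite ?lee_fin.
rewrite -EFinM -EFinD lee_fin -/c le_eqVlt; apply/orP; left; apply/eqP; ring.
Qed.

Lemma valid_c1_mono (L : nat) (rho lam tau alpha eta c c' : R) : c' <= c ->
  valid_c1 L rho lam tau alpha eta c -> valid_c1 L rho lam tau alpha eta c'.
Proof.
move=> cc' v d T P ns n sigma X W B ok F Flip FZ.
have [iF tailF] := v _ _ _ _ _ _ _ _ _ ok _ Flip; split => // t t0.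
apply: (le_trans (tailF t t0)); rewrite lee_fin ler_pM2l // ler_expR !mulNr lerN2.
by rewrite ler_wpM2r // tail_rate_ge0 //; case: ok => -[].
Qed.

(** This is where [eta] enters: scaling by n_0^(-1/2) gives the exponent n_0 t^2 / (50 rho^2), and
    n_0 >= eta >= A. *)
Lemma valid_c1_base (rho lam tau alpha eta A : R) : 0 < rho -> 0 < A -> A <= eta ->
  valid_c1 0 rho lam tau alpha eta ((50 * rho ^+ 2)^-1 * A).
Proof.
move=> rho0 A0 Aeta d T P ns n sigma X W B ok F Flip FZ.
case: ok => [[n0 ns0] [mX _] _ [sX _] [_ _ _ et]].
have n0R : (0 : R) < (ns 0%N)%:R by rewrite ltr0n ns0.
have s0 : 0 < (Num.sqrt (ns 0%N)%:R)^-1 :> R by rewrite invr_gt0 sqrtr_gt0.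
pose mx (x : 'I_(ns 0%N) * 'I_n -> R) := (\matrix_(i, j) x (i, j) : 'M[R]_(ns 0%N, n)).
pose g x := F ((Num.sqrt (ns 0%N)%:R)^-1 *: mx x).
have glip x y : `|g x - g y| <= (Num.sqrt (ns 0%N)%:R)^-1 * eucl (fun i => x i - y i).
  apply: (le_trans (Flip _ _)); rewrite -scalerBr hsnormZ (gtr0_norm s0).
  rewrite ler_pM2l // hsnormE le_eqVlt; apply/orP; left; apply/eqP; congr eucl.
  by apply/funext => -[i j]; rewrite /mxvecf !mxE.
have FZE : FZ = (fun w => g (mxvecf (X w))).
  apply/funext => w; rewrite /FZ /g /=; congr (F (_ *: _)).
  by apply/matrixP => i j; rewrite !mxE.
rewrite FZE; split; first by have := subgauss_lip_integrable rho0 mX sX s0 glip.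
move=> t t0; apply: (le_trans (subgauss_lip_mean rho0 mX sX s0 glip t0)).
rewrite lee_fin ler_pM2l // ler_expR !mulNr lerN2.
have -> : (rho * (Num.sqrt (ns 0%N)%:R)^-1) ^+ 2 = rho ^+ 2 / (ns 0%N)%:R.
  by rewrite exprMn exprVn sqr_sqrtr // ltW.
have -> : t ^+ 2 / (50 * (rho ^+ 2 / (ns 0%N)%:R))
    = (50 * rho ^+ 2)^-1 * ((ns 0%N)%:R * t ^+ 2) by field; rewrite !gt_eqF.
rewrite -mulrA ler_pM2l ?invr_gt0 ?mulr_gt0 ?exprn_gt0 //.
apply: ler_pM; rewrite ?(ltW A0) ?tail_rate_ge0 ?tail_rate_le_sqr //.
exact: le_trans et.
Qed.

(** Restores the prefactor 2 after a union bound. With y = e^(-x/3) the sum is 6 y^3. If 2y >= 1 the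
    bound p <= 1 suffices; otherwise y^2 <= 1/4 and 6 y^3 <= 2y. *)
Lemma three_tails_le (p x : R) :
  p <= 1 -> p <= 2 * expR (- x) + 2 * expR (- x) + 2 * expR (- x) ->
  p <= 2 * expR (- (x / 3)).
Proof.
move=> p1; have -> : expR (- x) = expR (- (x / 3)) ^+ 3.
  by rewrite -expRM_natl mulrN mulrC divfK.
have := expR_gt0 (- (x / 3)); move: (expR _) => y y0 py.
have [y1|y1] := leP 1 (2 * y); first exact: (le_trans p1 y1).
apply: (le_trans py).
have y2 : y ^+ 2 <= 4^-1.
  by rewrite (_ : 4^-1 = 2^-1 ^+ 2) ?ler_pXn2r ?nnegrE ?(ltW y0) //; lra.
have : y ^+ 3 <= 4^-1 * y by rewrite exprSr ler_wpM2r ?(ltW y0).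
lra.
Qed.

End Moment.

(** * The inductive step for one model and one Lipschitz function *)

Section Step.
Context {R : realType} {d : measure_display} {T : measurableType d}.
Variables (P : probability T R) (L : nat) (rho lam tau alpha eta : R).
Variables (ns : nat -> nat) (n : nat) (sigma : nat -> R -> R).
Variables (X : T -> 'M[R]_(ns 0%N, n)) (W : forall l : nat, T -> 'M[R]_(ns l.+1, ns l)).
Variables (B : forall l : nat, T -> 'cV[R]_(ns l.+1)).
Hypotheses (rho0 : 0 < rho) (lam0 : 0 < lam).
Hypothesis ok : model_ok L.+1 rho lam tau alpha eta P sigma X W B.
Variable F : 'M[R]_(ns L.+1, n) -> R.
Hypothesis Flip : lip1_hs F.

Local Notation Z l w := (Znet sigma (X w) (fun k => W k w) (fun k => B k w) l).
Local Notation f := (layer_mean P (W L) (B L) (sigma L) F).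

Let n0 : (0 < n)%N. Proof. by case: ok => -[]. Qed.
Let m0 : (0 < ns L.+1)%N. Proof. by case: ok => -[_ ns0] *; exact: ns0. Qed.
Let sl : lipschitz_R lam (sigma L).
Proof. by case: ok => _ _ _ _ [_ sig _ _]; exact: (sig L (ltnSn L)).1. Qed.
Let mWB : random_vec (fun w => wbvec (W L w) (B L w)).
Proof. by case: ok => _ [_ mWB'] _ _ _; exact: mWB'. Qed.
Let sWB : subgauss_conc P (fun w => wbvec (W L w) (B L w)) rho.
Proof. by case: ok => _ _ _ [_ sWB'] _; exact: sWB'. Qed.
Let cWB : centered P (fun w => wbvec (W L w) (B L w)).
Proof. by case: ok => _ _ _ _ [[_ cWB'] _ _ _]; exact: cWB'. Qed.

(** The summand 1 makes the constant at least 1, as the later use of [tail_rate_scale] requires. *)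
Lemma step_mean_lip Z1 Z2 : `|f Z1 - f Z2| <= (1 + 2 * rho * lam) * hsnorm (Z1 - Z2).
Proof.
apply: (le_trans (layer_mean_lip m0 n0 rho0 lam0 sl mWB sWB cWB Z1 Z2 Flip)).
by rewrite ler_wpM2r ?hsnorm_ge0 // lerDr.
Qed.

Let Lam : R := 1 + 2 * rho * lam.
Let Lam1 : 1 <= Lam. Proof. by rewrite lerDl !mulr_ge0 ?ltW. Qed.
Let Lam0 : 0 < Lam. Proof. exact: lt_le_trans Lam1. Qed.

Lemma step_rescaled_lip : lip1_hs (fun Z1 => Lam^-1 * f Z1).
Proof.
move=> Z1 Z2; rewrite -mulrBr normrM gtr0_norm ?invr_gt0 // ler_pdivrMl //.
exact: step_mean_lip.
Qed.

Lemma step_mean_measurable (d' : measure_display) (T' : measurableType d')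
    (V : T' -> 'M[R]_(ns L, n)) : (forall i j, measurable_fun setT (fun w => V w i j)) ->
  measurable_fun setT (fun w => f (V w)).
Proof.
move=> mV; have -> : (fun w => f (V w)) = (fun w => Lam * (Lam^-1 * f (V w))).
  by apply/funext => w; rewrite mulrA divff ?mul1r // gt_eqF.
apply: measurable_funM => //.
exact: (lip1_hs_measurable (F := fun Z1 => Lam^-1 * f Z1)) step_rescaled_lip mV.
Qed.

Hypothesis if_Z : P.-integrable setT (fun w => (f (Z L w))%:E).
Hypothesis iFZ : P.-integrable setT (fun w => (F (Z L.+1 w))%:E).

Lemma step_mean_mean : 'E_P[fun w => F (Z L.+1 w)]%E = 'E_P[fun w => f (Z L w)]%E.
Proof.
rewrite !expectationE.
have inner w : (\int[P]_w' (F (layer_map (sigma L) (W L w') (B L w') (Z L w)))%:E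
    = (f (Z L w))%:E)%E.
  rewrite /layer_mean expectationE fineK //.
  apply: integrable_fin_num => //.
  exact: (layer_integrable m0 n0 rho0 lam0 sl mWB sWB (Z L w) Flip).
under [RHS]eq_integral do rewrite -inner.
apply: (integral_indep (model_past_measurable ok) (model_last_measurable ok)
    (model_past_indep ok) (h := fun z => (F (layer_map (sigma L) (W L z.2) (B L z.2)
       (Z L z.1)))%:E)) => //.
- apply/measurable_EFinP; apply: lip1_hs_measurable => //.
  exact: (joint_layer_measurable lam0 ok).
- by move=> w; exact: (layer_integrable m0 n0 rho0 lam0 sl mWB sWB (Z L w) Flip).
- by apply: eq_integrable if_Z => // w _; rewrite -inner.
Qed.

(** The truncation is an event of the past. Once the past is frozen it either fails, leaving an
    empty event, or bounds the Lipschitz constant of the layer, so the conditional tail is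
    uniform. *)
Lemma step_conditional_tail (r t x : R) : 0 < t ->
  (forall V : 'M[R]_(ns L, n), hsnorm V < r ->
     x <= t ^+ 2 / (50 * (rho * layer_lip (ns L.+1) lam V) ^+ 2)) ->
  (P [set w | (hsnorm (Z L w) < r)%R /\ (t <= `|F (Z L.+1 w) - f (Z L w)|)%R]
    <= (2 * expR (- x))%:E)%E.
Proof.
move=> t0 hx.
apply: (probability_indep_le (model_past_measurable ok) (model_last_measurable ok)
  (model_past_indep ok) (E := [set z | (hsnorm (Z L z.1) < r)%R /\
     (t <= `|F (layer_map (sigma L) (W L z.2) (B L z.2) (Z L z.1)) - f (Z L z.1)|)%R])).
  have mZ1 i j : measurable_fun setT (fun z : g_sigma_algebraType (past_sets X W B L) *
      g_sigma_algebraType (coord_sets (fun w => wbvec (W L w) (B L w))) => Z L z.1 i j).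
    exact: measurableT_comp (past_Znet_measurable lam0 ok i j) _.
  apply: measurableI.
    apply: measurable_setlt => //.
    by apply: lip1_hs_measurable => //; exact: lip1_hs_hsnorm.
  apply: measurable_setle => //; apply: measurableT_comp => //.
  apply: measurable_funB; last exact: step_mean_measurable.
  by apply: lip1_hs_measurable => //; exact: (joint_layer_measurable lam0 ok).
move=> w /=; have [Zr|Zr] := ltP (hsnorm (Z L w)) r; last first.
  rewrite (_ : [set _ | _] = set0) ?measure0 ?lee_fin ?mulr_ge0 ?expR_ge0 //.
  by apply/seteqP; split => // w' [].
have := layer_conc m0 n0 rho0 lam0 sl mWB sWB (Z L w) Flip t0.
rewrite (_ : [set w' | true /\ _] =
  [set w' | (t <= `|F (layer_map (sigma L) (W L w') (B L w') (Z L w)) - f (Z L w)|)%R]).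
  move=> /le_trans; apply; rewrite lee_fin ler_pM2l // ler_expR mulNr lerN2.
  exact: hx.
by apply/seteqP; split => w' //= [].
Qed.

End Step.

(** * Constants uniform over all models *)

Section Concentration.
Context {R : realType}.

Lemma lip1_hs_integrable (d : measure_display) (T : measurableType d)
    (P : probability T R) (m n : nat) (V : T -> 'M[R]_(m, n)) (del : R)
    (F : 'M[R]_(m, n) -> R) :
  (forall i j, measurable_fun setT (fun w => V w i j)) -> 0 < del ->
  (\int[P]_w (hsnorm (V w) ^+ 2)%:E <= (del ^+ 2)%:E)%E -> lip1_hs F ->
  P.-integrable setT (fun w => (F (V w))%:E) /\ `|fine 'E_P[fun w => F (V w)]%E - F 0| <= del.
Proof.
move=> mV del0 Vdel Flip; have mF := lip1_hs_measurable Flip mV.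
apply: mean_near => //; apply: le_trans Vdel.
have mN := lip1_hs_measurable (@lip1_hs_hsnorm R m n) mV.
apply: ge0_le_integral_EFin => //.
- by apply: measurable_funX; exact: measurable_funB.
- exact: measurable_funX.
- by move=> w; rewrite sqr_ge0.
- move=> w; rewrite -[leLHS]real_normK ?num_real // ler_pXn2r ?nnegrE ?hsnorm_ge0 //.
  by apply: (le_trans (Flip _ _)); rewrite subr0.
Qed.

(** [K'] is fixed before [alpha] and [eta], which act only through the common factor [A]; this keeps
    the constants linear in [A] along the induction. *)
Lemma valid_c1_step (L : nat) (rho lam tau K : R) :
  0 < rho -> 0 < lam -> 0 <= tau -> 0 < K -> exists K' : R, 0 < K' /\
  forall alpha eta A, 0 < alpha -> 0 < A -> A <= alpha^-1 ->
    valid_c1 L rho lam tau alpha eta (K * A) ->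
    valid_c1 L.+1 rho lam tau alpha eta (K' * A).
Proof.
move=> rho0 lam0 tau0 K0.
have [C [C0 momZ]] := Znet_moment L rho0 lam0 tau0.
have [C' [C'0 momZ']] := Znet_moment L.+1 rho0 lam0 tau0.
pose Lam := 1 + 2 * rho * lam.
have Lam1 : 1 <= Lam by rewrite lerDl !mulr_ge0 ?ltW.
have Lam0 : 0 < Lam by exact: lt_le_trans Lam1.
(* 200 = 4 * 50 comes from the deviation t/2 and the factor 50 of [layer_conc]; (sqrt C + 2) sqrt (n
   u) bounds |Z| + sqrt n below the truncation level. *)
pose k0 := (200 * rho ^+ 2 * lam ^+ 2 * (Num.sqrt C + 2) ^+ 2)^-1.
have sC0 : 0 < Num.sqrt C + 2 by rewrite ltr_wpDl ?sqrtr_ge0.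
have k00 : 0 < k0 by rewrite invr_gt0 !mulr_gt0 ?exprn_gt0.
(* The first bound serves the conditional mean, whose deviation t/2 is normalized by [Lam]; the
   second serves the conditional tail. The tail of the norm needs K2 <= K, which follows from the
   first. *)
pose K2 := Num.min (K / (2 * Lam) ^+ 2) k0.
have L20 : 0 < (2 * Lam) ^+ 2 by rewrite exprn_gt0 // mulr_gt0.
have K20 : 0 < K2 by rewrite lt_min divr_gt0.
have K2l : K2 <= K / (2 * Lam) ^+ 2 by rewrite ge_min lexx.
have K2r : K2 <= k0 by rewrite ge_min lexx orbT.
have K2K : K2 <= K.
  apply: (le_trans K2l); rewrite ler_pdivrMr // ler_peMr ?(ltW K0) //.
  by rewrite exprn_ege1 //; lra.
exists (K2 / 3); split; first by rewrite divr_gt0.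
move=> alpha eta A al0 A0 Aal IH d T P ns n sigma X W B ok F Flip FZ.
have ok' := model_ok_pred ok.
have [[n0 ns0] _ _ _ [_ _ al _]] := ok.
have nR : (0 : R) < n%:R by rewrite ltr0n.
have mR : (0 : R) < (ns L.+1)%:R by rewrite ltr0n ns0.
have mZ := model_ok_Znet_measurable lam0 ok'.
pose Z w := Znet sigma (X w) (fun k => W k w) (fun k => B k w) L.
pose f := layer_mean P (W L) (B L) (sigma L) F.
have glip := step_rescaled_lip rho0 lam0 ok Flip.
(* The induction hypothesis is used twice, for the normalized conditional mean and for the norm. *)
have [ig tailg] := IH _ _ _ _ _ _ _ _ _ ok' _ glip.
have [_ tailN] := IH _ _ _ _ _ _ _ _ _ ok' _ (@lip1_hs_hsnorm R _ _).
have del_gt0 (D : R) : 0 < D -> 0 < Num.sqrt (D * n%:R).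
  by move=> D0; rewrite sqrtr_gt0 mulr_gt0.
have del_sqr (D : R) : 0 < D -> Num.sqrt (D * n%:R) ^+ 2 = D * n%:R.
  by move=> D0; rewrite sqr_sqrtr // mulr_ge0 // ltW.
have [_ EN] : P.-integrable setT (fun w => (hsnorm (Z w))%:E) /\
    `|fine 'E_P[fun w => hsnorm (Z w)]%E - hsnorm (0 : 'M[R]_(ns L, n))| <= Num.sqrt (C * n%:R).
  apply: lip1_hs_integrable => //; first exact: del_gt0.
    by rewrite del_sqr //; exact: momZ ok'.
  exact: lip1_hs_hsnorm.
have {}EN : fine 'E_P[fun w => hsnorm (Z w)]%E <= Num.sqrt (C * n%:R).
  have h0 : hsnorm (0 : 'M[R]_(ns L, n)) = 0.
    by rewrite -(scale0r (0 : 'M[R]_(ns L, n))) hsnormZ normr0 mul0r.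
  by move: EN; rewrite h0 subr0; apply: le_trans; exact: ler_norm.
have [iFZ _] : P.-integrable setT (fun w => (FZ w)%:E) /\
    `|fine 'E_P[FZ]%E - F 0| <= Num.sqrt (C' * n%:R).
  apply: lip1_hs_integrable => //.
  - exact: model_ok_Znet_measurable ok.
  - exact: del_gt0.
  - by rewrite del_sqr //; exact: momZ' ok.
have if_Z : P.-integrable setT (fun w => (f (Z w))%:E).
  have := integrableZl measurableT Lam ig; apply: eq_integrable => // w _.
  by rewrite -EFinM mulrA divff ?mul1r // gt_eqF.
have EFf : 'E_P[FZ]%E = 'E_P[fun w => f (Z w)]%E by exact: (step_mean_mean rho0 lam0 ok Flip if_Z iFZ).
have Eg : fine 'E_P[fun w => (Lam^-1 * f (Z w))%R]%E = Lam^-1 * fine 'E_P[FZ]%E.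
  rewrite EFf !expectationE; under eq_integral do rewrite EFinM.
  by rewrite integralZl // fineM // integrable_fin_num.
split=> // t t0.
pose x := K2 * A * tail_rate L.+1 n t.
have rate0 : 0 <= tail_rate L.+1 n t by exact: tail_rate_ge0.
have rateL : tail_rate L.+1 n t <= tail_rate L n t by exact: tail_rate_le_pred.
have [u [u1 ru rt]] := tail_rate_split L n0 t0.
have u0 : 0 < u by exact: lt_le_trans u1.
have nu0 : 0 < Num.sqrt (n%:R * u) by rewrite sqrtr_gt0 mulr_gt0.
(* The mean of |Z| is at most sqrt (C n), so |Z| >= r is a deviation of at least sqrt (n u). [ru]
   bounds its tail, [rt] the conditional tail below [r]. *)
pose r := Num.sqrt (C * n%:R) + Num.sqrt (n%:R * u).
have mFZ : measurable_fun setT FZ by case/integrableP: iFZ => /measurable_EFinP.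
have mf : measurable_fun setT (fun w => f (Z w)).
  by case/integrableP: if_Z => /measurable_EFinP.
have mN : measurable_fun setT (fun w => hsnorm (Z w)).
  by apply: lip1_hs_measurable => //; exact: lip1_hs_hsnorm.
have mabs (Y : T -> R) s : measurable_fun setT Y -> measurable [set w | (s <= `|Y w|)%R].
  by move=> mY; apply: measurable_setle => //; exact: measurableT_comp.
pose S1 := [set w | (r <= hsnorm (Z w))%R].
pose S2 := [set w | (hsnorm (Z w) < r)%R /\ (t / 2 <= `|FZ w - f (Z w)|)%R].
pose S3 := [set w | (t / 2 <= `|f (Z w) - fine 'E_P[FZ]%E|)%R].
have mS1 : measurable S1 by exact: measurable_setle.
have mS2 : measurable S2.
  apply: measurableI; first exact: measurable_setlt.
  by apply: mabs; exact: measurable_funB.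
have mS3 : measurable S3 by apply: mabs; exact: measurable_funB.
have PS1 : (P S1 <= (2 * expR (- x))%:E)%E.
  apply: (@le_trans _ _ (P [set w | (Num.sqrt (n%:R * u)
      <= `|hsnorm (Z w) - fine 'E_P[fun w => hsnorm (Z w)]%E|)%R])).
    apply: le_measure; rewrite ?inE //; first by apply: mabs; exact: measurable_funB.
    move=> w; rewrite /S1 /r /= => rZ; apply: (le_trans _ (ler_norm _)).
    by rewrite lerBrDl (le_trans _ rZ) // lerD2r.
  apply: (le_trans (tailN _ nu0)); rewrite lee_fin ler_pM2l // ler_expR mulNr lerN2.
  by rewrite /x ler_pM ?mulr_ge0 ?(ltW K20) ?(ltW A0) // ler_wpM2r ?(ltW A0).
have PS2 : (P S2 <= (2 * expR (- x))%:E)%E.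
  have t20 : 0 < t / 2 by rewrite divr_gt0.
  apply: (step_conditional_tail rho0 lam0 ok Flip t20) => V Vr.
  have hV : hsnorm V + Num.sqrt n%:R <= Num.sqrt (n%:R * u) * (Num.sqrt C + 2).
    have su1 : 1 <= Num.sqrt u by rewrite -sqrtr1 ler_sqrt // ltW.
    have sn : 0 <= Num.sqrt n%:R :> R by exact: sqrtr_ge0.
    have nsu : Num.sqrt n%:R <= Num.sqrt n%:R * Num.sqrt u by rewrite ler_peMr.
    have Cnsu : Num.sqrt C * Num.sqrt n%:R <= Num.sqrt C * (Num.sqrt n%:R * Num.sqrt u).
      by rewrite ler_wpM2l ?sqrtr_ge0.
    move: Vr; rewrite /r !sqrtrM ?(ltW nR) ?(ltW C0) // => /ltW.
    move: Cnsu nsu; set y := Num.sqrt n%:R * Num.sqrt u.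
    rewrite mulrDr [y * Num.sqrt C]mulrC; lra.
  have hV2 : (hsnorm V + Num.sqrt n%:R) ^+ 2 <= n%:R * u * (Num.sqrt C + 2) ^+ 2.
    have -> : n%:R * u = Num.sqrt (n%:R * u) ^+ 2 by rewrite sqr_sqrtr // ltW ?mulr_gt0.
    by rewrite -exprMn ler_pXn2r ?nnegrE ?addr_ge0 ?hsnorm_ge0 ?sqrtr_ge0 // mulr_ge0 ?ltW.
  have lip2 : (rho * layer_lip (ns L.+1) lam V) ^+ 2
      <= rho ^+ 2 * lam ^+ 2 * (Num.sqrt C + 2) ^+ 2 * (A^-1 * u).
    rewrite /layer_lip !exprMn exprVn sqr_sqrtr ?(ltW mR) //.
    (* This is where [alpha] enters: n / n_(L+1) <= alpha <= 1/A. *)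
    have nm : n%:R / (ns L.+1)%:R <= A^-1.
      apply: (le_trans (al L.+1 _)); first by rewrite leqnn.
      by rewrite -[alpha]invrK lef_pV2 ?posrE ?invr_gt0.
    apply: (@le_trans _ _ (rho ^+ 2 * (lam ^+ 2 / (ns L.+1)%:R *
        (n%:R * u * (Num.sqrt C + 2) ^+ 2)))).
      rewrite ler_pM2l ?exprn_gt0 // ler_pM2l // divr_gt0 ?exprn_gt0 //.
    rewrite (_ : rho ^+ 2 * _ = rho ^+ 2 * lam ^+ 2 * (Num.sqrt C + 2) ^+ 2 *
      (n%:R / (ns L.+1)%:R * u)); last by field; rewrite gt_eqF.
    by rewrite ler_pM2l ?mulr_gt0 ?exprn_gt0 // ler_pM2r.
  have lip0 : 0 < (rho * layer_lip (ns L.+1) lam V) ^+ 2.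
    by rewrite exprn_gt0 // mulr_gt0 // layer_lip_gt0 // ns0.
  have D0 : 0 < rho ^+ 2 * lam ^+ 2 * (Num.sqrt C + 2) ^+ 2 * (A^-1 * u).
    by rewrite !mulr_gt0 ?exprn_gt0 ?invr_gt0.
  apply: (@le_trans _ _ ((t / 2) ^+ 2 / (50 *
      (rho ^+ 2 * lam ^+ 2 * (Num.sqrt C + 2) ^+ 2 * (A^-1 * u))))); last first.
    rewrite ler_pM2l ?exprn_gt0 // lef_pV2 ?posrE;
      [by rewrite ler_pM2l|exact: mulr_gt0|exact: mulr_gt0].
  have -> : (t / 2) ^+ 2 / (50 *
      (rho ^+ 2 * lam ^+ 2 * (Num.sqrt C + 2) ^+ 2 * (A^-1 * u))) = k0 * A * (t ^+ 2 / u).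
    by rewrite /k0; field; rewrite !gt_eqF.
  by rewrite /x ler_pM ?mulr_ge0 ?(ltW K20) ?(ltW A0) // ler_wpM2r ?(ltW A0).
have PS3 : (P S3 <= (2 * expR (- x))%:E)%E.
  have tL : 0 < t / (2 * Lam) by rewrite divr_gt0 // mulr_gt0.
  have := tailg _ tL; rewrite /= -/f -/Lam Eg.
  rewrite (_ : [set w | _] = S3).
    move=> /le_trans; apply; rewrite lee_fin ler_pM2l // ler_expR mulNr lerN2.
    have sc := @tail_rate_scale _ L n (2 * Lam) t n0 t0 ltac:(lra).
    apply: (@le_trans _ _ (K / (2 * Lam) ^+ 2 * A * tail_rate L n t)).
      by rewrite /x ler_pM ?mulr_ge0 ?(ltW K20) ?(ltW A0) // ler_wpM2r ?(ltW A0).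
    have -> : K / (2 * Lam) ^+ 2 * A * tail_rate L n t
        = K * A * (tail_rate L n t / (2 * Lam) ^+ 2).
      by rewrite -!mulrA; congr (_ * _); rewrite [RHS]mulrA mulrC.
    by rewrite ler_pM2l ?mulr_gt0 // ler_pdivrMr // mulrC.
  have tE : Lam * (t / (2 * Lam)) = t / 2.
    by rewrite invfM mulrCA [Lam * _]mulrCA divff ?mulr1 // gt_eqF.
  apply/seteqP; split => w; rewrite /S3 /= -/(Z w) -mulrBr normrM gtr0_norm ?invr_gt0 //.
    by rewrite ler_pdivlMl // tE.
  by rewrite ler_pdivlMl // tE.
have mS : measurable [set w | (t <= `|FZ w - fine 'E_P[FZ]%E|)%R].
  by apply: mabs; exact: measurable_funB.
have PS : (P [set w | (t <= `|FZ w - fine 'E_P[FZ]%E|)%R] <= P S1 + P S2 + P S3)%E.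
  apply: le_trans (leeD2r _ (measureU2 P mS1 mS2)).
  apply: le_trans (measureU2 P (measurableU _ _ mS1 mS2) mS3).
  apply: le_measure; rewrite ?inE //; first by apply: measurableU => //; exact: measurableU.
  move=> w /= tw; have [rZ|Zr] := leP r (hsnorm (Z w)); first by left; left.
  have [tf|ft] := leP (t / 2) `|f (Z w) - fine 'E_P[FZ]%E|; first by right.
  left; right; split => //.
  have := ler_distD (f (Z w)) (FZ w) (fine 'E_P[FZ]%E); lra.
have fS := fin_num_measure P _ mS.
rewrite -(fineK fS) lee_fin.
rewrite (_ : - (K2 / 3 * A) * _ = - (x / 3)); last by rewrite /x; field.
apply: three_tails_le.
  by rewrite -lee_fin fineK // probability_le1.
rewrite -lee_fin fineK // !EFinD; apply: (le_trans PS).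
by apply: leeD => //; apply: leeD.
Qed.

(** [A] is left free below 1/alpha and eta: its largest value gives existence, a prescribed value
    gives divergence. *)
Lemma valid_c1_exists (L : nat) (rho lam tau : R) :
  0 < rho -> 0 < lam -> 0 <= tau -> exists K : R, 0 < K /\
  forall alpha eta A, 0 < alpha -> 0 < A -> A <= alpha^-1 -> A <= eta ->
    valid_c1 L rho lam tau alpha eta (K * A).
Proof.
move=> rho0 lam0 tau0; elim: L => [|L [K [K0 IH]]].
  exists (50 * rho ^+ 2)^-1; split; first by rewrite invr_gt0 mulr_gt0 ?exprn_gt0.
  by move=> alpha eta A _ A0 _ Aeta; exact: valid_c1_base.
have [K' [K'0 step]] := valid_c1_step L rho0 lam0 tau0 K0.
by exists K'; split => // alpha eta A al0 A0 Aal Aeta; apply: step => //; exact: IH.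
Qed.

(** * Bounded last activation *)

Lemma hsnorm_bounded_layer (m k n : nat) (s : R -> R) (kappa : R) (w : 'M[R]_(m, k))
    (b : 'cV[R]_m) (V : 'M[R]_(k, n)) : (0 < m)%N -> (forall x, `|s x| <= kappa) ->
  hsnorm (layer_map s w b V) ^+ 2 <= kappa ^+ 2 * n%:R.
Proof.
move=> m0 sk; have mR : (0 : R) < m%:R by rewrite ltr0n.
have k0 : 0 <= kappa by exact: le_trans (sk 0).
rewrite hsnormZ exprMn real_normK ?num_real // exprVn sqr_sqrtr ?(ltW mR) //.
rewrite ler_pdivrMl // sqr_hsnorm.
have -> : m%:R * (kappa ^+ 2 * n%:R) = \sum_(i < m) \sum_(j < n) kappa ^+ 2.
  by rewrite mulr_natr mulr_natl !sumr_const !card_ord.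
apply: ler_sum => i _; apply: ler_sum => j _; rewrite mxE.
by rewrite -[leLHS]real_normK ?num_real // ler_pXn2r ?nnegrE.
Qed.

(* |F(Z_L) - E F(Z_L)| is at most of order sqrt n, a range of t on which
   t^2 is comparable with the rate. *)
Lemma valid_c2_of_valid_c1 (L : nat) (rho lam tau kappa alpha eta c : R) :
  (0 < L)%N -> 0 < lam -> 0 <= c -> valid_c1 L rho lam tau alpha eta c ->
  valid_c2 L rho lam tau kappa alpha eta (c / (4 * kappa ^+ 2 + 2)).
Proof.
case: L => // L _ lam0 c0 v d T P ns n sigma X W B ok sk F Flip FZ.
have [iF tailF] := v _ _ _ _ _ _ _ _ _ ok _ Flip; split => // t t0.
have [[n0 ns0] _ _ _ _] := ok.
have nR : (0 : R) < n%:R by rewrite ltr0n.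
(* (|Z| + del)^2 <= 2 (|Z|^2 + del^2) <= (4 kappa^2 + 2) n, so the event is empty as soon as t^2 > b
   n. *)
pose b := 4 * kappa ^+ 2 + 2.
have b1 : 1 <= b by rewrite /b; have := sqr_ge0 kappa; lra.
have b0 : 0 < b by exact: lt_le_trans b1.
have [tb|bt] := leP (t ^+ 2) (b * n%:R).
  apply: (le_trans (tailF t t0)); rewrite lee_fin ler_pM2l // ler_expR !mulNr lerN2.
  by rewrite mulrAC -mulrA ler_wpM2l // ler_pdivrMr // mulrC sqr_le_tail_rate.
pose Z w := Znet sigma (X w) (fun k => W k w) (fun k => B k w) L.+1.
have Z2 w : hsnorm (Z w) ^+ 2 <= kappa ^+ 2 * n%:R.
  by apply: hsnorm_bounded_layer => //; exact: ns0.
have mZ := model_ok_Znet_measurable lam0 ok.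
(* The added 1 keeps [del] positive even for kappa = 0. *)
pose del := Num.sqrt ((kappa ^+ 2 + 1) * n%:R).
have k1 : 0 < kappa ^+ 2 + 1 by rewrite ltr_wpDl ?sqr_ge0.
have del0 : 0 < del by rewrite sqrtr_gt0 mulr_gt0.
have del2 : del ^+ 2 = (kappa ^+ 2 + 1) * n%:R by rewrite sqr_sqrtr // ltW ?mulr_gt0.
have [_ EF] : P.-integrable setT (fun w => (FZ w)%:E) /\ `|fine 'E_P[FZ]%E - F 0| <= del.
  apply: lip1_hs_integrable => //.
  apply: (@le_trans _ _ (\int[P]_w (del ^+ 2)%:E)%E); last by rewrite integral_cst_prob.
  apply: ge0_le_integral_EFin => //.
  - by apply: measurable_funX; apply: lip1_hs_measurable => //; exact: lip1_hs_hsnorm.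
  - by move=> w; rewrite sqr_ge0.
  - by move=> w; apply: (le_trans (Z2 w)); rewrite del2 ler_pM2r // lerDl.
rewrite (_ : [set w | _] = set0) ?measure0 ?lee_fin ?mulr_ge0 ?expR_ge0 //.
apply/seteqP; split => // w /=; apply/negP; rewrite -ltNge.
rewrite -(@ltr_pXn2r _ 2) ?nnegrE ?(ltW t0) //; apply: le_lt_trans bt.
have Zdel : hsnorm (Z w) <= del.
  rewrite -(@ler_pXn2r _ 2) ?nnegrE ?hsnorm_ge0 ?(ltW del0) //.
  by apply: (le_trans (Z2 w)); rewrite del2 ler_pM2r // lerDl.
have F0 : `|FZ w - F 0| <= hsnorm (Z w) by apply: (le_trans (Flip _ _)); rewrite subr0.
have h : `|FZ w - fine 'E_P[FZ]%E| <= hsnorm (Z w) + del.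
  by apply: (le_trans (ler_distD (F 0) _ _)); rewrite lerD // distrC.
apply: (@le_trans _ _ ((hsnorm (Z w) + del) ^+ 2)).
  by rewrite ler_pXn2r ?nnegrE ?addr_ge0 ?hsnorm_ge0 ?(ltW del0).
have := Z2 w; have := sqr_ge0 (hsnorm (Z w) - del).
rewrite sqrrB sqrrD del2 /b; lra.
Qed.

Lemma valid_c2_mono (L : nat) (rho lam tau kappa alpha eta c c' : R) : c' <= c ->
  valid_c2 L rho lam tau kappa alpha eta c -> valid_c2 L rho lam tau kappa alpha eta c'.
Proof.
move=> cc' v d T P ns n sigma X W B ok sk F Flip FZ.
have [iF tailF] := v _ _ _ _ _ _ _ _ _ ok sk _ Flip; split => // t t0.
apply: (le_trans (tailF t t0)); rewrite lee_fin ler_pM2l // ler_expR !mulNr lerN2.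
by rewrite ler_wpM2r // sqr_ge0.
Qed.

End Concentration.

(** Divergence is expressed without a supremum: each [M] is itself a valid constant once
    [alpha < delta] and [H <= eta], so the optimal constant is at least [M]. *)
Theorem theorem3p10 (R : realType) :
  (* first inequality: a valid constant c > 0 exists *)
  (forall (L : nat) (rho lam tau alpha eta : R),
     (0 < L)%N -> 0 < rho -> 0 < lam -> 0 < alpha -> 0 <= tau -> 1 <= eta ->
     exists c : R, 0 < c /\ valid_c1 L rho lam tau alpha eta c) /\
  (* second inequality under sup |sigma_{L-1}| <= kappa *)
  (forall (L : nat) (rho lam tau kappa alpha eta : R),
     (0 < L)%N -> 0 < rho -> 0 < lam -> 0 < alpha -> 0 <= tau -> 1 <= eta ->
     exists c' : R, 0 < c' /\ valid_c2 L rho lam tau kappa alpha eta c') /\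
  (* optimal constants diverge as alpha -> 0 and eta -> oo simultaneously *)
  (forall (L : nat) (rho lam tau : R),
     (0 < L)%N -> 0 < rho -> 0 < lam -> 0 <= tau ->
     forall M : R, exists delta : R, exists H : R, 0 < delta /\
       forall alpha eta : R, 0 < alpha -> alpha < delta -> H <= eta -> 1 <= eta ->
         valid_c1 L rho lam tau alpha eta M) /\
  (forall (L : nat) (rho lam tau kappa : R),
     (0 < L)%N -> 0 < rho -> 0 < lam -> 0 <= tau ->
     forall M : R, exists delta : R, exists H : R, 0 < delta /\
       forall alpha eta : R, 0 < alpha -> alpha < delta -> H <= eta -> 1 <= eta ->
         valid_c2 L rho lam tau kappa alpha eta M).
Proof.
have max_min (alpha eta : R) : 0 < alpha -> 1 <= eta -> 0 < Num.min alpha^-1 eta.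
  by move=> al0 eta1; rewrite lt_min invr_gt0 al0 (lt_le_trans ltr01).
have c1 (L : nat) (rho lam tau alpha eta : R) :
    0 < rho -> 0 < lam -> 0 < alpha -> 0 <= tau -> 1 <= eta ->
    exists c : R, 0 < c /\ valid_c1 L rho lam tau alpha eta c.
  move=> rho0 lam0 al0 tau0 eta1.
  have [K [K0 vK]] := valid_c1_exists L rho0 lam0 tau0.
  exists (K * Num.min alpha^-1 eta); split; first by rewrite mulr_gt0 // max_min.
  by apply: vK => //; rewrite ?max_min // ge_min lexx ?orbT.
have c1_large (L : nat) (rho lam tau : R) : 0 < rho -> 0 < lam -> 0 <= tau ->
    forall M : R, exists delta : R, exists H : R, 0 < delta /\
      forall alpha eta : R, 0 < alpha -> alpha < delta -> H <= eta ->
        valid_c1 L rho lam tau alpha eta M.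
  move=> rho0 lam0 tau0 M; have [K [K0 vK]] := valid_c1_exists L rho0 lam0 tau0.
  have M0 : 0 < `|M| + 1 by rewrite ltr_wpDl.
  (* The value A = (|M| + 1)/K makes K A exceed [M]; A <= 1/alpha and A <= eta dictate [delta] and
     [H]. Adding 1 to |M| makes [A] positive for every [M]. *)
  exists (K / (`|M| + 1)), ((`|M| + 1) / K); split; first by rewrite divr_gt0.
  move=> alpha eta al0 ald He; apply: (@valid_c1_mono _ _ _ _ _ _ _ (K * ((`|M| + 1) / K))).
    rewrite mulrCA divff ?gt_eqF // mulr1; apply: (le_trans (ler_norm M)).
    by rewrite lerDl.
  apply: vK => //; first by rewrite divr_gt0.
  by rewrite -[_ / K]invrK invf_div lef_pV2 ?posrE ?divr_gt0 // ltW.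
split; first by move=> L rho lam tau alpha eta _; exact: c1.
split.
  move=> L rho lam tau kappa alpha eta L0 rho0 lam0 al0 tau0 eta1.
  have [c [c0 vc]] := c1 L rho lam tau alpha eta rho0 lam0 al0 tau0 eta1.
  exists (c / (4 * kappa ^+ 2 + 2)); split; last exact: valid_c2_of_valid_c1 (ltW c0) vc.
  by rewrite divr_gt0 // ltr_wpDl // mulr_ge0 ?sqr_ge0.
split.
  move=> L rho lam tau _ rho0 lam0 tau0 M.
  have [delta [H [delta0 vM]]] := c1_large L rho lam tau rho0 lam0 tau0 M.
  by exists delta, H; split => // alpha eta al0 ald He _; exact: vM.
move=> L rho lam tau kappa L0 rho0 lam0 tau0 M.
have b0 : 0 < 4 * kappa ^+ 2 + 2 by rewrite ltr_wpDl // mulr_ge0 ?sqr_ge0.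
(* The factor 4 kappa^2 + 2 compensates the loss in [valid_c2_of_valid_c1], and |M| provides the
   nonnegative constant that lemma asks for. *)
have [delta [H [delta0 vM]]] :=
  c1_large L rho lam tau rho0 lam0 tau0 (`|M| * (4 * kappa ^+ 2 + 2)).
exists delta, H; split => // alpha eta al0 ald He _.
apply: (@valid_c2_mono _ _ _ _ _ _ _ _ (`|M| * (4 * kappa ^+ 2 + 2) / (4 * kappa ^+ 2 + 2))).
  by rewrite mulfK ?gt_eqF // ler_norm.
apply: valid_c2_of_valid_c1 => //; first by rewrite mulr_ge0 // ltW.
exact: vM.
Qed.
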